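(* Let $G$ be a two-party communication gadget, and let $\mathrm{QSZK}^{\mathrm{cc}}$ be a communication complexity measure satisfying $\mathrm{QSZK}^{\mathrm{cc}}(F)=O(\mathrm{Q}^{\mathrm{cc}}(F))$ for every two-party partial function $F$. Suppose that for every partial Boolean function $f$ we have $\mathrm{QSZK}^{\mathrm{cc}}(f\circ G)=\widetilde{\Omega}(\mathrm{QSZK}(f))$. Then for every partial Boolean function $f$ we have $\mathrm{Q}^{\mathrm{cc}}(f\circ G)=\widetilde{\Omega}(\mathrm{Q}(f))$.
   Context: Quantum query model: the oracle $O_x$ acts by $O_x|i,b\rangle=|i,b\oplus x_i\rangle$. A $T$-query algorithm alternates input-independent unitaries with $T$ applications of $O_x$, starting from $|0^m\rangle$. It then measures, or outputs the state obtained by tracing out a fixed subset of qubits. The trace distance is $\|\rho-\sigma\|_{tr}=\tfrac12\|\rho-\sigma\|_1$. - $\mathrm{Q}(f)$ is the minimum number of queries to compute $f$ with success probability at least $2/3$ on every $x\in\mathrm{Dom}(f)$. - $\mathrm{QSZK}(f)$ is the smallest $k$ such that two quantum query algorithms, making $k$ queries in total, output on input $x\in\mathrm{Dom}(f)$ states $\rho_x,\sigma_x$ of the same dimension with $\|\rho_x-\sigma_x\|_{tr}\ge 2/3$ if $f(x)=1$ and $\|\rho_x-\sigma_x\|_{tr}\le1/3$ if $f(x)=0$. A gadget is $G:\mathcal{X}\times\mathcal{Y}\to\{0,1\}$. For a partial $f$ on $n$ bits, $f\circ G$ is the two-party partial function with Alice holding $(a_i)\in\mathcal{X}^n$ and Bob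 holding $(b_i)\in\mathcal{Y}^n$. Its value is $f(G(a_1,b_1),\dots,G(a_n,b_n))$, defined when this string lies in $\mathrm{Dom}(f)$. $\mathrm{Q}^{\mathrm{cc}}(F)$ is the bounded-error quantum communication complexity of $F$. The notation $\widetilde{\Omega}(g)$ means $\Omega(g/\log^c g)$ for some constant $c$. *)

(* Defs.v *)
(* with mathcomp-reals (realType) and real_closed's complex numbers. *)
From HB Require Import structures.
From mathcomp Require Import all_boot all_order all_algebra.
From mathcomp Require Import reals.
From mathcomp Require Import complex.
From Stdlib Require Import ClassicalEpsilon.
Set Implicit Arguments. Unset Strict Implicit. Unset Printing Implicit Defensive.
Import Order.TTheory GRing.Theory Num.Theory.
Local Open Scope ring_scope.

(* Generic helpers                                                     *)

(* least natural number satisfying P (meaningful when one exists) *)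
Definition natmin (P : nat -> Prop) : nat :=
  epsilon (inhabits 0%N) (fun m => P m /\ forall m', P m' -> (m <= m')%N).

Section Quantum.
Variable R : realType.
Local Notation C := (R[i]).

(* squared modulus |z|^2 as a real number *)
Definition amp2 (z : C) : R := (complex.Re z) ^+ 2 + (complex.Im z) ^+ 2.

(* operators and vectors on the Hilbert space with orthonormal basis S *)
Definition Op (S : finType) := S -> S -> C.
Definition Vec (S : finType) := S -> C.

Definition opmul (S : finType) (A B : Op S) : Op S :=
  fun s t => \sum_(u : S) A s u * B u t.
Definition opapp (S : finType) (A : Op S) (v : Vec S) : Vec S :=
  fun s => \sum_(t : S) A s t * v t.
(* U^dagger U = I (equivalent to unitarity in finite dimension) *)
Definition unitary (S : finType) (U : Op S) : Prop :=
  forall s t, \sum_(u : S) (U u s)^* * U u t = (s == t)%:R.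

(* Schatten-1 (trace) norm: sum of the singular values, A = V diag(sigma) W^dagger *)
Definition trnorm (K : finType) (A : Op K) : R :=
  epsilon (inhabits 0) (fun t => exists (V W : Op K) (sigma : K -> R),
    [/\ unitary V, unitary W, (forall k, 0 <= sigma k),
        (forall a b, A a b = \sum_(k : K) V a k * ((sigma k)%:C)%C * (W b k)^*)
      & t = \sum_(k : K) sigma k]).

(* trace distance ||rho - sigma||_tr = 1/2 ||rho - sigma||_1 *)
Definition trdist (K : finType) (rho sigma : Op K) : R :=
  2^-1 * trnorm (fun a b => rho a b - sigma a b).

(* Quantum query model                                                 *)

(* basis states of the algorithm's register: p index qubits, the query
   qubit b, j workspace qubits that are kept as output, l further
   workspace qubits (traced out / never output) *)
Definition QSt (p j l : nat) : finType :=
  ({ffun 'I_p -> bool} * bool * {ffun 'I_j -> bool} * {ffun 'I_l -> bool})%type.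

(* integer encoded by the index qubits *)
Definition bits_val (p : nat) (i : {ffun 'I_p -> bool}) : nat :=
  (\sum_(k < p) (i k : nat) * 2 ^ k)%N.

(* x_m, with the convention x_m = 0 for out-of-range indices m >= n *)
Definition xbit (n : nat) (x : {ffun 'I_n -> bool}) (m : nat) : bool :=
  if insub m is Some i then x i else false.

(* O_x |i, b, w> = |i, b xor x_i, w> *)
Definition oracle (n p j l : nat) (x : {ffun 'I_n -> bool}) : Op (QSt p j l) :=
  fun s t => ((s.1.1.1 == t.1.1.1) && (s.1.1.2 == t.1.1.2 (+) xbit x (bits_val t.1.1.1))
              && (s.1.2 == t.1.2) && (s.2 == t.2))%:R.

Definition qinit (p j l : nat) : QSt p j l :=
  ([ffun=> false], false, [ffun=> false], [ffun=> false]).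

Definition basis (S : finType) (s0 : S) : Vec S := fun s => (s == s0)%:R.

(* state after U_t O_x U_(t-1) ... O_x U_0 |0^m> *)
Fixpoint qrun (n p j l : nat) (U : nat -> Op (QSt p j l)) (x : {ffun 'I_n -> bool})
  (t : nat) : Vec (QSt p j l) :=
  match t with
  | 0 => opapp (U 0%N) (basis (qinit p j l))
  | t'.+1 => opapp (U t) (opapp (@oracle n p j l x) (qrun U x t'))
  end.

(* partial Boolean function on n bits: None outside Dom(f) *)
Definition pbool_fun (n : nat) := {ffun 'I_n -> bool} -> option bool.

(* f is computed by a T-query algorithm with success probability >= 2/3 *)
Definition query_computes (n : nat) (f : pbool_fun n) (T : nat) : Prop :=
  exists (p j l : nat) (U : nat -> Op (QSt p j l)) (out : QSt p j l -> bool),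
    (forall t, (t <= T)%N -> unitary (U t)) /\
    forall x v, f x = Some v ->
      2 / 3 <= \sum_(s : QSt p j l | out s == v) amp2 (qrun U x T s).

(* Q(f) *)
Definition Qquery (n : nat) (f : pbool_fun n) : nat := natmin (query_computes f).

(* output state: the reduced density matrix on the j kept workspace qubits
   (all other qubits traced out) *)
Definition reduced (p j l : nat) (psi : Vec (QSt p j l)) : Op {ffun 'I_j -> bool} :=
  fun a a' => \sum_(s : QSt p j l | s.1.2 == a) psi s * (psi (s.1.1, a', s.2))^*.

(* two query algorithms making k queries in total whose output states
   (of the same dimension 2^j) are far iff f(x) = 1 *)
Definition szk_computes (n : nat) (f : pbool_fun n) (k : nat) : Prop :=
  exists (j p1 l1 T1 : nat) (U1 : nat -> Op (QSt p1 j l1))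
         (p2 l2 T2 : nat) (U2 : nat -> Op (QSt p2 j l2)),
    [/\ (T1 + T2)%N = k,
        (forall t, (t <= T1)%N -> unitary (U1 t)),
        (forall t, (t <= T2)%N -> unitary (U2 t)) &
        forall x v, f x = Some v ->
          let d := trdist (reduced (qrun U1 x T1)) (reduced (qrun U2 x T2)) in
          (v = true -> 2 / 3 <= d) /\ (v = false -> d <= 1 / 3)].

(* QSZK(f) *)
Definition QSZKquery (n : nat) (f : pbool_fun n) : nat := natmin (szk_computes f).

(* Quantum communication complexity (no prior entanglement)            *)

(* global register of N qubits; at each time Alice owns a set of qubits
   and Bob owns the complement *)
Definition Str (N : nat) : finType := {ffun 'I_N -> bool}.

Definition mask (N : nat) (Q : {set 'I_N}) (s : Str N) : Str N :=
  [ffun i => (i \in Q) && s i].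

Definition agree_off (N : nat) (Q : {set 'I_N}) (s t : Str N) : bool :=
  [forall i, (i \notin Q) ==> (s i == t i)].

(* U is a unitary of the form u (x) Id, with u acting on the qubits in Q *)
Definition localop (N : nat) (Q : {set 'I_N}) (U : Op (Str N)) : Prop :=
  unitary U /\ exists u : Str N -> Str N -> C,
    forall s t, U s t = (agree_off Q s t)%:R * u (mask Q s) (mask Q t).

(* state after T steps; in step t Alice applies UA t a to her qubits and
   Bob applies UB t b to his qubits; ownership then changes to own t.+1 *)
Fixpoint crun (N : nat) (I J : Type) (UA : nat -> I -> Op (Str N))
  (UB : nat -> J -> Op (Str N)) (a : I) (b : J) (t : nat) : Vec (Str N) :=
  match t with
  | 0 => basis [ffun=> false]
  | t'.+1 => opapp (UB t' b) (opapp (UA t' a) (crun UA UB a b t'))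
  end.

(* number of qubits sent (each change of ownership of a qubit is one
   qubit of communication) *)
Definition ccost (N : nat) (own : nat -> {set 'I_N}) (T : nat) : nat :=
  (\sum_(t < T) #|(own t :\: own t.+1) :|: (own t.+1 :\: own t)|)%N.

(* F is computed with error <= 1/3 by a protocol communicating c qubits;
   the output is the measurement of qubit out at the end *)
Definition comm_computes (I J : finType) (F : I -> J -> option bool) (c : nat) : Prop :=
  exists (N T : nat) (own : nat -> {set 'I_N})
         (UA : nat -> I -> Op (Str N)) (UB : nat -> J -> Op (Str N)) (out : 'I_N),
    [/\ ccost own T = c,
        (forall t a, (t < T)%N -> localop (own t) (UA t a)),
        (forall t b, (t < T)%N -> localop (~: own t) (UB t b)) &
        forall a b v, F a b = Some v ->
          2 / 3 <= \sum_(s : Str N | s out == v) amp2 (crun UA UB a b T s)].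

(* Q^cc(F) *)
Definition Qcc (I J : finType) (F : I -> J -> option bool) : nat :=
  natmin (comm_computes F).

End Quantum.

(* f o G (composition with the gadget) *)
Definition gcompose (X Y : finType) (n : nat) (f : pbool_fun n) (G : X -> Y -> bool)
  (a : {ffun 'I_n -> X}) (b : {ffun 'I_n -> Y}) : option bool :=
  f [ffun i => G (a i) (b i)].

(* Main.v *)
(* Fix f and let C = Q^cc(f o G), m = C + 1. Let f' take inputs x_1, ..., x_k of f and an array of 2^k blocks of m bits, and output the parity of the block with address f(x_1)...f(x_k), where k is about log Q(f). Running the protocol for f o G on the k instances and then sending m symbols shows Q^cc(f' o G) = O(k^2 m), so the hypothesis gives a QSZK algorithm for f' with T <= m polylog Q(f) queries.
   Flipping any bit of the addressed block changes f', so the adversary argument for parity shows that the total query weight on that block is Omega(m); hence measuring a random query reveals the whole address with probability p >= Omega(m/T) >= 1 / polylog Q(f). The block length m matters here: with one-bit blocks one would only get 1/T^2 (Grover search).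
   If every T-query algorithm had advantage at most eps on some distribution of inputs of f, the probability a_i of revealing the first i address bits would satisfy a_(i+1) <= a_i / 2 + eps, so a_k <= 2^-k + 2 eps < p, a contradiction. By the minimax theorem f therefore has a T-query algorithm with worst-case advantage 1 / polylog, and majority voting yields Q(f) <= T polylog <= C polylog. *)

(* The hypothesis says little about [f] itself, because [QSZK(f)] can be far below [Q(f)]; it is
   spent on a function for which separating the output states already forces knowledge of many
   values of [f]. The array carries no promise: every content is legal, so it can be averaged over,
   flipped bit by bit, and hard-wired independently of the instances. Beyond chance, query weight
   then reaches the addressed block only by computing the address. The logarithm in the hypothesis
   is that of the QSZK complexity of the lookup function, which is not bounded in advance in terms
   of [Q(f)]. [polylog_bootstrap] removes this circularity; it needs [m <= 2 ^ L], hence the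
   separate trivial case [Q(f) <= C]. Algorithms are handled in a phase-query model, where a query
   multiplies basis states by signs: averaging, repetition and hard-wiring become direct sums,
   tensor products and renaming of positions. Bit-query algorithms enter and leave this model with
   the same number of queries. *)
From mathcomp Require Import all_boot all_order all_algebra.
From mathcomp Require Import reals complex spectral ring lra zify.
From Stdlib Require Import Classical ClassicalEpsilon FunctionalExtensionality.
Require Import Defs.
Set Implicit Arguments. Unset Strict Implicit. Unset Printing Implicit Defensive.
Import Order.TTheory GRing.Theory Num.Theory.
Local Open Scope ring_scope.
Local Open Scope sesquilinear_scope.

(** * Linear algebra and the trace norm *)

Section LinearAlgebra.
Variable R : realType.
Local Notation C := (R[i]).
Local Notation "x %:C" := (real_complex R x) (format "x %:C") : ring_scope.
Implicit Types (S K L : finType).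

Lemma conjE (z : C) : z^* = conjc z. Proof. by []. Qed.

Lemma amp2E (z : C) : (amp2 z)%:C = z^* * z.
Proof. by rewrite /amp2 add_Re2_Im2 sqr_normc mulrC. Qed.

Lemma amp2_ge0 (z : C) : 0 <= amp2 z.
Proof. by rewrite addr_ge0 ?sqr_ge0. Qed.

Lemma amp2M (z w : C) : amp2 (z * w) = amp2 z * amp2 w.
Proof.
by apply: (@complexI R); rewrite [RHS]rmorphM/= !amp2E rmorphM/= mulrACA.
Qed.

Lemma amp2_real (x : R) : amp2 x%:C = x ^+ 2.
Proof. by rewrite /amp2 /= expr0n addr0. Qed.

Lemma amp2_nat (b : bool) : amp2 (b%:R : C) = b%:R.
Proof.
rewrite -[b%:R](rmorph_nat (real_complex R)) amp2_real.
by case: b; rewrite ?expr1n ?expr0n.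
Qed.

Lemma amp2_prod (I : finType) (F : I -> C) : amp2 (\prod_i F i) = \prod_i amp2 (F i).
Proof.
apply: (big_morph (@amp2 R)) => [z w|]; first exact: amp2M.
by rewrite (amp2_nat true).
Qed.

Lemma amp2_sign (b : bool) (z : C) : amp2 ((-1) ^+ b * z) = amp2 z.
Proof.
rewrite amp2M -[(-1) ^+ b](rmorph_sign (real_complex R)) amp2_real.
by rewrite sqrr_sign mul1r.
Qed.

Lemma ReD (z w : C) : complex.Re (z + w) = complex.Re z + complex.Re w.
Proof. by case: z w => ? ? []. Qed.
Lemma ReN (z : C) : complex.Re (- z) = - complex.Re z.
Proof. by case: z. Qed.
Lemma Re_sum (I : finType) (P : pred I) (F : I -> C) :
  complex.Re (\sum_(i | P i) F i) = \sum_(i | P i) complex.Re (F i).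
Proof. by apply: (big_morph _ ReD). Qed.
Lemma cRe_conj (z : C) : complex.Re z^* = complex.Re z.
Proof. by rewrite conjE; case: z. Qed.
Lemma Re_scale (x : R) (z : C) : complex.Re (x%:C * z) = x * complex.Re z.
Proof. by case: z => a b /=; rewrite mul0r subr0. Qed.

Definition dot S (v w : Vec R S) : C := \sum_s (v s)^* * w s.
Definition nsq S (v : Vec R S) : R := \sum_s amp2 (v s).

Lemma nsqE S (v : Vec R S) : (nsq v)%:C = dot v v.
Proof. by rewrite rmorph_sum; apply: eq_bigr => s _; rewrite -amp2E. Qed.

Lemma nsq_Re S (v : Vec R S) : nsq v = complex.Re (dot v v).
Proof. by rewrite -nsqE. Qed.

(** A weighted Cauchy-Schwarz inequality: the right side minus the left is [l^-1] times the squared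
    modulus of [l z - w]. The weight stays free until [szk_separation] fixes it. *)
Lemma Re_mul_le (l : R) (z w : C) : 0 < l ->
  2 * complex.Re (z^* * w) <= l * amp2 z + l^-1 * amp2 w.
Proof.
move=> l0; rewrite conjE; case: z w => a b [c d]; rewrite /amp2 /=.
rewrite mulNr opprK -subr_ge0.
have -> : l * (a ^+ 2 + b ^+ 2) + l^-1 * (c ^+ 2 + d ^+ 2) - 2 * (a * c + b * d)
  = l^-1 * ((l * a - c) ^+ 2 + (l * b - d) ^+ 2) by field; rewrite lt0r_neq0.
by rewrite mulr_ge0 ?addr_ge0 ?sqr_ge0 // invr_ge0 ltW.
Qed.

Lemma Re_dot_le S (l : R) (v w : Vec R S) : 0 < l ->
  2 * complex.Re (dot v w) <= l * nsq v + l^-1 * nsq w.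
Proof.
move=> l0; rewrite Re_sum !mulr_sumr -big_split /=.
by apply: ler_sum => s _; apply: Re_mul_le.
Qed.

Lemma dotC S (v w : Vec R S) : dot v w = (dot w v)^*.
Proof. by rewrite rmorph_sum; apply: eq_bigr => s _; rewrite rmorphM /= conjCK mulrC. Qed.

Lemma dotBl S (u v w : Vec R S) : dot (fun s => u s - v s) w = dot u w - dot v w.
Proof. by rewrite -sumrB; apply: eq_bigr => s _; rewrite rmorphB mulrBl. Qed.

Lemma dotBr S (u v w : Vec R S) : dot w (fun s => u s - v s) = dot w u - dot w v.
Proof. by rewrite -sumrB; apply: eq_bigr => s _; rewrite mulrBr. Qed.

Lemma nsqB S (v w : Vec R S) :
  nsq (fun s => v s - w s) = nsq v + nsq w - 2 * complex.Re (dot v w).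
Proof.
rewrite !nsq_Re dotBl !dotBr; rewrite [dot w v]dotC !(ReD, ReN) cRe_conj; ring.
Qed.

Lemma opappB S (U : Op R S) (v w : Vec R S) :
  opapp U (fun s => v s - w s) = (fun s => opapp U v s - opapp U w s).
Proof.
apply: functional_extensionality => s; rewrite /opapp -sumrB.
by apply: eq_bigr => t _; rewrite mulrBr.
Qed.

Lemma sum_deltal S (s : S) (F : S -> C) : \sum_t (s == t)%:R * F t = F s.
Proof.
rewrite (bigD1 s) //= eqxx mul1r big1 ?addr0 // => t; rewrite eq_sym => /negbTE ->.
by rewrite mul0r.
Qed.

Lemma sum_deltar S (s : S) (F : S -> C) : \sum_t F t * (t == s)%:R = F s.
Proof.
by under eq_bigr do rewrite mulrC eq_sym; rewrite sum_deltal.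
Qed.

Definition idop S : Op R S := fun s t => (s == t)%:R.

Lemma opapp_id S (v : Vec R S) : opapp (@idop S) v = v.
Proof. by apply: functional_extensionality => s; rewrite /opapp sum_deltal. Qed.

Lemma opapp_mul S (A B : Op R S) (v : Vec R S) : opapp (opmul A B) v = opapp A (opapp B v).
Proof.
apply: functional_extensionality => s; rewrite /opapp /opmul.
under eq_bigr do rewrite mulr_suml.
rewrite exchange_big /=; apply: eq_bigr => t _; rewrite mulr_sumr.
by apply: eq_bigr => u _; rewrite mulrA.
Qed.

Lemma unitary_dot S (U : Op R S) (v w : Vec R S) :
  unitary U -> dot (opapp U v) (opapp U w) = dot v w.
Proof.
move=> uU; rewrite /dot /opapp.
transitivity (\sum_s \sum_t \sum_u (v t)^* * w u * ((U s t)^* * U s u)).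
  apply: eq_bigr => s _; rewrite rmorph_sum mulr_suml; apply: eq_bigr => t _.
  by rewrite mulr_sumr; apply: eq_bigr => u _; rewrite rmorphM; ring.
rewrite exchange_big /=; apply: eq_bigr => t _; rewrite exchange_big /=.
under eq_bigr do rewrite -mulr_sumr uU eq_sym.
by rewrite sum_deltar mulrC.
Qed.

Lemma unitary_nsq S (U : Op R S) (v : Vec R S) : unitary U -> nsq (opapp U v) = nsq v.
Proof. by move=> uU; rewrite !nsq_Re unitary_dot. Qed.

Lemma unitaryE S (U : Op R S) :
  unitary U <-> forall s t, dot (fun u => U u s) (fun u => U u t) = (s == t)%:R.
Proof. by []. Qed.

Lemma unitary_id S : unitary (@idop S).
Proof.
move=> s t; rewrite (eq_bigr (fun u => (s == u)%:R * (u == t)%:R)).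
  by rewrite sum_deltal.
by move=> u _; rewrite /idop rmorph_nat eq_sym.
Qed.

Lemma opapp_delta S (A : Op R S) s : opapp A (fun t => (t == s)%:R) = (fun u => A u s).
Proof. by apply: functional_extensionality => u; rewrite /opapp sum_deltar. Qed.

Lemma opmul_col S (A B : Op R S) t :
  (fun s => opmul A B s t) = opapp A (fun s => B s t).
Proof. by []. Qed.

Lemma unitary_mul S (A B : Op R S) : unitary A -> unitary B -> unitary (opmul A B).
Proof.
by move=> uA uB; apply/unitaryE => s t; rewrite !opmul_col unitary_dot //; exact: uB.
Qed.

Lemma reindex_enum (M : nmodType) S (F : S -> M) : \sum_s F s = \sum_(i < #|S|) F (enum_val i).
Proof.
rewrite (reindex (@enum_val S S)) //=; exists enum_rank => i _; [exact: enum_valK|exact: enum_rankK].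
Qed.

Definition mxop S K (A : S -> K -> C) : 'M[C]_(#|S|, #|K|) :=
  \matrix_(i, j) A (enum_val i) (enum_val j).

Lemma mxop_mul S K L (A : S -> K -> C) (B : K -> L -> C) :
  mxop A *m mxop B = mxop (fun s t => \sum_u A s u * B u t).
Proof.
apply/matrixP => i j; rewrite !mxE (reindex_enum (fun u => A _ u * B u _)).
by apply: eq_bigr => k _; rewrite !mxE.
Qed.

Lemma mxop_delta S : mxop (fun s t : S => (s == t)%:R : C) = 1%:M.
Proof. by apply/matrixP => i j; rewrite !mxE (inj_eq enum_val_inj). Qed.

Lemma mxop_inj S K (A B : S -> K -> C) : mxop A = mxop B -> forall s t, A s t = B s t.
Proof.
move=> /matrixP e s t; have := e (enum_rank s) (enum_rank t).
by rewrite !mxE !enum_rankK.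
Qed.

Lemma unitary_row S (U : Op R S) s t :
  unitary U -> \sum_u U s u * (U t u)^* = (s == t)%:R.
Proof.
move=> uU; pose Ud : Op R S := fun a b => (U b a)^*.
have : mxop Ud *m mxop U = 1%:M.
  rewrite mxop_mul -mxop_delta; congr mxop.
  by do 2 (apply: functional_extensionality => ?); exact: uU.
move=> /mulmx1C; rewrite mxop_mul -mxop_delta => /mxop_inj; exact.
Qed.

Lemma mulmx1C_eq (n m : nat) (A : 'M[C]_(m, n)) (B : 'M[C]_(n, m)) : m = n ->
  A *m B = 1%:M -> B *m A = 1%:M.
Proof. by move=> e; move: A B; rewrite e => A B /mulmx1C. Qed.

Lemma unitarymx_complement (m n : nat) (A : 'M[C]_(m, n)) : A *m A ^t* = 1%:M ->
  exists2 N : 'M[C]_(n - m, n), N *m N ^t* = 1%:M & A *m N ^t* = 0.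
Proof.
move=> uA; have rA : \rank A = m by apply: mxrank_unitary; apply/unitarymxP.
pose Y := orthomx Num.Def.conjC (mx_of_hermitian (hermitian1mx n)) A.
have rY : \rank Y = (n - m)%N by rewrite rank_ortho rA.
pose N := schmidt (row_base Y).
have uN : N *m N ^t* = 1%:M.
  by apply/unitarymxP; apply: schmidt_unitarymx; apply: rank_leq_col.
have sN : (N <= Y)%MS by rewrite (eqmx_schmidt_free (row_base_free _)) eq_row_base.
have oN : A *m N ^t* = 0.
  have e := orthomx1P sN; apply: (can_inj (@trmxCK _ _ _)).
  by rewrite trmx_mul map_mxM trmxCK e !raddf0.
by move: N uN oN {sN}; rewrite rY => N uN oN; exists N.
Qed.

(* A linear isometry between two subspaces extends to a unitary: complete both orthonormal families to orthonormal bases. *)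
Lemma unitary_extend S K (E E' : S -> Vec R K) :
  (forall s t, dot (E s) (E t) = (s == t)%:R) ->
  (forall s t, dot (E' s) (E' t) = (s == t)%:R) ->
  exists2 W : Op R K, unitary W & forall s, opapp W (E s) = E' s.
Proof.
move=> oE oE'; pose A (F : S -> Vec R K) := mxop F.
have uA F : (forall s t, dot (F s) (F t) = (s == t)%:R) -> A F *m (A F) ^t* = 1%:M.
  move=> oF; rewrite -mxop_delta.
  apply/matrixP => i j; rewrite !mxE eq_sym -oF /dot (@reindex_enum _ K).
  by apply: eq_bigr => k _; rewrite !mxE mulrC.
have [N uN oN] := unitarymx_complement (uA _ oE).
have [N' uN' oN'] := unitarymx_complement (uA _ oE').
pose B := col_mx (A E) N; pose B' := col_mx (A E') N'.
have leSK : (#|S| + (#|K| - #|S|) = #|K|)%N.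
  apply: subnKC; rewrite -(mxrank_unitary (introT unitarymxP (uA _ oE))).
  exact: rank_leq_col.
have ucol (X : 'M[C]_(#|S|, #|K|)) (Y : 'M[C]_(#|K| - #|S|, #|K|)) :
    X *m X ^t* = 1%:M -> Y *m Y ^t* = 1%:M -> X *m Y ^t* = 0 ->
    col_mx X Y *m (col_mx X Y) ^t* = 1%:M.
  move=> uX uY oXY; rewrite tr_col_mx map_row_mx mul_col_row uX uY oXY.
  have -> : Y *m X ^t* = 0.
    by apply: (can_inj (@trmxCK _ _ _)); rewrite trmx_mul map_mxM trmxCK oXY !raddf0.
  by rewrite -scalar_mx_block.
have uB := ucol _ _ (uA _ oE) uN oN; have uB' := ucol _ _ (uA _ oE') uN' oN'.
pose P := B ^t* *m B'.
have uP : P *m P ^t* = 1%:M.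
  rewrite /P trmx_mul map_mxM trmxCK -mulmxA (mulmxA B') uB' mul1mx.
  exact: (mulmx1C_eq leSK uB).
have AP : A E *m P = A E'.
  rewrite /P mulmxA /B tr_col_mx map_row_mx mul_mx_row (uA _ oE) oN /B'.
  by rewrite mul_row_col mul1mx mul0mx addr0.
exists (fun u k => P (enum_rank k) (enum_rank u)) => [s t|s].
  have /matrixP/(_ (enum_rank t) (enum_rank s)) := uP.
  rewrite !mxE (inj_eq enum_rank_inj) eq_sym => <-.
  rewrite (@reindex_enum _ K); apply: eq_bigr => k _.
  by rewrite !mxE enum_valK mulrC.
apply: functional_extensionality => u; rewrite /opapp.
have /matrixP/(_ (enum_rank s) (enum_rank u)) := AP.
rewrite !mxE !enum_rankK => <-; rewrite (@reindex_enum _ K).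
by apply: eq_bigr => k _; rewrite !mxE enum_rankK enum_valK mulrC.
Qed.

Definition svd_of K (A : Op R K) (t : R) := exists (V W : Op R K) (sigma : K -> R),
    [/\ unitary V, unitary W, (forall k, 0 <= sigma k),
        (forall a b, A a b = \sum_(k : K) V a k * (sigma k)%:C * (W b k)^*)
      & t = \sum_(k : K) sigma k].

(** By the spectral theorem the singular values are the absolute eigenvalues; [W] is [V] with the
    columns of negative eigenvalues negated. *)
Lemma hermitian_svd K (A : Op R K) : (forall a b, A b a = (A a b)^*) -> exists t, svd_of A t.
Proof.
move=> hA; pose M := mxop A.
have hM : M \is hermsymmx.
  apply/is_hermitianmxP; rewrite expr0 scale1r; apply/matrixP => i j.
  by rewrite !mxE -hA.
have /orthomx_spectralP := hermitian_normalmx hM.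
set P := spectralmx M; set d := spectral_diag M => eM.
have uP : P \is unitarymx by apply: spectral_unitarymx.
rewrite invmx_unitary // in eM.
have uPr : P ^t* *m P = 1%:M by apply: mulmx1C; apply/unitarymxP.
have uPl : P *m P ^t* = 1%:M by apply/unitarymxP.
have rd k : d 0 k \is Num.real.
  by apply: (mxOverP (hermitian_spectral_diag_real hM)).
pose dk (k : K) := complex.Re (d 0 (enum_rank k)).
have dE k : d 0 (enum_rank k) = (dk k)%:C by rewrite /dk RRe_real.
pose V : Op R K := fun a k => (P (enum_rank k) (enum_rank a))^*.
have uV : unitary V.
  move=> s t; have /matrixP/(_ (enum_rank s) (enum_rank t)) := uPl.
  rewrite !mxE (inj_eq enum_rank_inj) => <-; rewrite (@reindex_enum _ K).
  by apply: eq_bigr => k _; rewrite !mxE /V conjCK enum_valK.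
exists (\sum_k `|dk k|), V, (fun b k => (-1) ^+ (dk k < 0)%R * V b k), (fun k => `|dk k|).
split=> // [s t|a b].
  rewrite (eq_bigr (fun u => ((-1) ^+ (dk s < 0)%R * (-1) ^+ (dk t < 0)%R) * ((V u s)^* * V u t))).
    rewrite -mulr_sumr uV; case: eqP => [->|_]; last by rewrite mulr0.
    by rewrite -expr2 sqrr_sign mulr1.
  by move=> u _; rewrite rmorphM rmorph_sign /= mulrACA.
have /matrixP/(_ (enum_rank a) (enum_rank b)) := eM.
rewrite /M [in X in X -> _]mxE !enum_rankK => ->.
rewrite mxE (@reindex_enum _ K); apply: eq_bigr => k _.
rewrite mul_mx_diag !mxE /V -{2}(enum_valK k) dE !rmorphM rmorph_sign /= conjCK !enum_valK.
rewrite -[in LHS]mulrA -[in RHS]mulrA; congr (_ * _).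
rewrite mulrA; congr (_ * _).
by rewrite {1}[dk _]numEsign [LHS]rmorphM [X in X * _]rmorph_sign mulrC.
Qed.

Lemma trnorm_svd K (A : Op R K) : (forall a b, A b a = (A a b)^*) -> svd_of A (trnorm A).
Proof. by move=> /hermitian_svd [t ht]; apply: (epsilon_spec (inhabits 0)); exists t. Qed.

Definition trpair K (M A : Op R K) : C := \sum_a \sum_b M b a * A a b.

Lemma trpair_svd K (M A V W : Op R K) (sigma : K -> R) :
  (forall a b, A a b = \sum_k V a k * (sigma k)%:C * (W b k)^*) ->
  trpair M A = \sum_k (sigma k)%:C * dot (fun b => W b k) (opapp M (fun a => V a k)).
Proof.
move=> eA; rewrite /trpair.
under eq_bigr do under eq_bigr do rewrite eA mulr_sumr.
under eq_bigr do rewrite exchange_big.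
rewrite exchange_big /=; apply: eq_bigr => k _; rewrite exchange_big mulr_sumr.
apply: eq_bigr => b _; rewrite /opapp !mulr_sumr.
by apply: eq_bigr => a _; ring.
Qed.

Lemma nsq_unitary_col K (V : Op R K) k : unitary V -> nsq (fun a => V a k) = 1.
Proof. by move=> uV; rewrite nsq_Re /dot uV eqxx. Qed.

(** [trnorm] picks some decomposition by choice. This bound and [trnorm_attained] together identify
    its value as the maximum of Re tr(MA) over unitary [M], so the uniqueness of singular values
    never has to be proved. *)
Lemma trnorm_ge K (M A : Op R K) : (forall a b, A b a = (A a b)^*) -> unitary M ->
  complex.Re (trpair M A) <= trnorm A.
Proof.
move=> /trnorm_svd [V [W [sigma [uV uW s0 eA ->]]]] uM.
rewrite (trpair_svd M eA) Re_sum; apply: ler_sum => k _.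
rewrite Re_scale -[leRHS]mulr1; apply: ler_wpM2l => //.
have := Re_dot_le (fun b => W b k) (opapp M (fun a => V a k)) ltr01.
rewrite unitary_nsq // !nsq_unitary_col // invr1; lra.
Qed.

Lemma trnorm_attained K (A : Op R K) : (forall a b, A b a = (A a b)^*) ->
  exists2 M, unitary M & trnorm A = complex.Re (trpair M A).
Proof.
move=> /trnorm_svd [V [W [sigma [uV uW s0 eA ->]]]].
pose Vd : Op R K := fun s t => (V t s)^*.
have uVd : unitary Vd.
  move=> s t; rewrite -(unitary_row s t uV).
  by apply: eq_bigr => u _; rewrite /Vd conjCK.
exists (opmul W Vd); first exact: unitary_mul.
rewrite (trpair_svd _ eA) Re_sum; apply: eq_bigr => k _; rewrite Re_scale.
rewrite opapp_mul.
have -> : opapp Vd (fun a => V a k) = (fun t => (t == k)%:R).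
  by apply: functional_extensionality => s; rewrite -uV.
by rewrite opapp_delta /dot uW eqxx /= mulr1.
Qed.

(** The unnormalised state of the kept qubits when the discarded ones are found in [e]. The reduced
    density matrix is the sum over [e] of the projectors onto these vectors, so pairing it with [M]
    gives a sum of quadratic forms. *)
Definition slice p j l (psi : Vec R (QSt p j l))
    (e : {ffun 'I_p -> bool} * bool * {ffun 'I_l -> bool}) : Vec R {ffun 'I_j -> bool} :=
  fun a => psi (e.1, a, e.2).

Lemma sum_slice (M : nmodType) p j l (F : QSt p j l -> M) :
  \sum_s F s = \sum_e \sum_a F (e.1, a, e.2).
Proof.
rewrite pair_big /=.
rewrite (reindex (fun q : {ffun 'I_p -> bool} * bool * {ffun 'I_l -> bool} * {ffun 'I_j -> bool} =>
  (q.1.1, q.2, q.1.2) : QSt p j l)) //=.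
exists (fun s => ((s.1.1, s.2), s.1.2)) => -[[? ?] ?] _ //=.
Qed.

Lemma trpair_reduced p j l (M : Op R {ffun 'I_j -> bool}) (psi : Vec R (QSt p j l)) :
  trpair M (reduced psi) = \sum_e dot (slice psi e) (opapp M (slice psi e)).
Proof.
rewrite /trpair.
transitivity (\sum_a \sum_b \sum_e M b a * (slice psi e a * (slice psi e b)^*)).
  apply: eq_bigr => a _; apply: eq_bigr => b _; rewrite -mulr_sumr; congr (_ * _).
  rewrite /reduced big_mkcond sum_slice /=; apply: eq_bigr => e _.
  rewrite (bigD1 a) //= eqxx big1 ?addr0 // => c /negbTE.
  by move=> ->.
under eq_bigr do rewrite exchange_big.
rewrite exchange_big; apply: eq_bigr => e _; rewrite exchange_big.
apply: eq_bigr => b _; rewrite mulr_sumr; apply: eq_bigr => a _ /=; ring.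
Qed.

Lemma reducedE p j l (psi : Vec R (QSt p j l)) a b :
  reduced psi a b = \sum_e slice psi e a * (slice psi e b)^*.
Proof.
rewrite /reduced big_mkcond sum_slice /=; apply: eq_bigr => e _.
rewrite (bigD1 a) //= eqxx big1 ?addr0 // => c /negbTE.
by move=> ->.
Qed.

Lemma reduced_herm p j l (psi : Vec R (QSt p j l)) a b : reduced psi b a = (reduced psi a b)^*.
Proof.
rewrite !reducedE rmorph_sum; apply: eq_bigr => e _.
by rewrite rmorphM /= conjCK mulrC.
Qed.

Lemma trpairB K (M A B : Op R K) :
  trpair M (fun a b => A a b - B a b) = trpair M A - trpair M B.
Proof.
rewrite /trpair -sumrB; apply: eq_bigr => a _; rewrite -sumrB; apply: eq_bigr => b _.
by rewrite mulrBr.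
Qed.

Lemma nsq_slice p j l (psi : Vec R (QSt p j l)) : \sum_e nsq (slice psi e) = nsq psi.
Proof. by rewrite /nsq sum_slice. Qed.

(** On each slice, with [d = u - v], adding and subtracting <v, Mu> leaves two terms that are linear
    in [d]; each is bounded by [Re_dot_le]. *)
Lemma trpair_reduced_le p j l (M : Op R {ffun 'I_j -> bool}) (psi phi : Vec R (QSt p j l)) (lam : R) :
  unitary M -> nsq psi = 1 -> nsq phi = 1 -> 0 < lam ->
  complex.Re (trpair M (reduced psi)) - complex.Re (trpair M (reduced phi)) <=
  lam * nsq (fun s => psi s - phi s) + lam^-1.
Proof.
move=> uM n1 n2 lam0; rewrite !trpair_reduced !Re_sum -sumrB.
have -> : lam^-1 = \sum_e 2^-1 * (lam^-1 * (nsq (slice psi e) + nsq (slice phi e))).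
  by rewrite -!mulr_sumr big_split /= !nsq_slice n1 n2; field; rewrite lt0r_neq0.
rewrite -nsq_slice mulr_sumr -big_split /=; apply: ler_sum => e _.
set u := slice psi e; set v := slice phi e.
have -> : slice (fun s => psi s - phi s) e = (fun a => u a - v a) by [].
set d := fun a => u a - v a.
have h1 := Re_dot_le d (opapp M u) lam0.
have h2 := Re_dot_le (opapp M d) v lam0.
rewrite !unitary_nsq // in h1 h2.
have e1 : complex.Re (dot u (opapp M u)) - complex.Re (dot v (opapp M v)) =
  complex.Re (dot d (opapp M u)) + complex.Re (dot (opapp M d) v).
  rewrite [dot (opapp M d) v]dotC cRe_conj /d opappB dotBl dotBr !(ReD, ReN); ring.
rewrite e1; lra.
Qed.

(** Both trace distances are tested with the one unitary that is optimal for the [psi] pair; for the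
    [phi] pair it still gives a lower bound. *)
Lemma trdist_reduced_le p1 l1 p2 l2 j (psi1 phi1 : Vec R (QSt p1 j l1))
    (psi2 phi2 : Vec R (QSt p2 j l2)) (lam : R) :
  nsq psi1 = 1 -> nsq phi1 = 1 -> nsq psi2 = 1 -> nsq phi2 = 1 -> 0 < lam ->
  2 * (trdist (reduced psi1) (reduced psi2) - trdist (reduced phi1) (reduced phi2)) <=
  lam * (nsq (fun s => psi1 s - phi1 s) + nsq (fun s => psi2 s - phi2 s)) + 2 * lam^-1.
Proof.
move=> n1 m1 n2 m2 lam0.
have hh (q1 q2 : Op R {ffun 'I_j -> bool}) :
  (forall a b, q1 b a = (q1 a b)^*) -> (forall a b, q2 b a = (q2 a b)^*) ->
  forall a b, (fun a b => q1 a b - q2 a b) b a = ((fun a b => q1 a b - q2 a b) a b)^*.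
  by move=> h1 h2 a b /=; rewrite h1 h2 rmorphB.
have [M uM e1] := trnorm_attained (hh _ _ (reduced_herm psi1) (reduced_herm psi2)).
have g2 := trnorm_ge (hh _ _ (reduced_herm phi1) (reduced_herm phi2)) uM.
rewrite /trdist {}e1; move: g2; rewrite !trpairB !(ReD, ReN) => g2.
have k1 := trpair_reduced_le uM n1 m1 lam0.
have k2 := trpair_reduced_le uM m2 n2 lam0.
have -> : nsq (fun s => psi2 s - phi2 s) = nsq (fun s => phi2 s - psi2 s).
  by rewrite !nsqB n2 m2 [dot psi2 _]dotC cRe_conj.
lra.
Qed.
End LinearAlgebra.

(** * Phase queries *)

Section PhaseModel.
Variable R : realType.
Local Notation C := (R[i]).
Local Notation "x %:C" := (real_complex R x) (format "x %:C") : ring_scope.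
Implicit Types (S K : finType).

(** The position may depend on the time and on the whole basis state, and a position outside the
    input gives the sign +1. It thus serves as a null query, which makes padding and idling
    possible. *)
Fixpoint prun n S (v0 : Vec R S) (U : nat -> Op R S) (pos : nat -> S -> nat)
    (x : {ffun 'I_n -> bool}) (t : nat) : Vec R S :=
  match t with
  | 0 => v0
  | t'.+1 => opapp (U t') (fun s => (-1) ^+ xbit x (pos t' s) * prun v0 U pos x t' s)
  end.

(** An algorithm is represented by its output distribution [p], so that convex combinations and
    products of algorithms are literally those of functions. *)
Definition phase_alg n (T : nat) (O : finType) (p : {ffun 'I_n -> bool} -> O -> R) : Prop :=
  exists (S : finType) (v0 : Vec R S) (U : nat -> Op R S) (pos : nat -> S -> nat) (out : S -> O),
    [/\ nsq v0 = 1, (forall t, unitary (U t)) &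
        forall x w, p x w = \sum_(s | out s == w) amp2 (prun v0 U pos x T s)].

Lemma prun_nsq n S (v0 : Vec R S) U pos (x : {ffun 'I_n -> bool}) t :
  nsq v0 = 1 -> (forall t, unitary (U t)) -> nsq (prun v0 U pos x t) = 1.
Proof.
move=> n1 uU; elim: t => //= t <-; rewrite unitary_nsq //.
by apply: eq_bigr => s _; rewrite amp2_sign.
Qed.

Lemma phase_alg_ge0 n T (O : finType) (p : {ffun 'I_n -> bool} -> O -> R) x w : phase_alg T p -> 0 <= p x w.
Proof. by case=> S [v0 [U [pos [out [_ _ ->]]]]]; apply: sumr_ge0 => s _; apply: amp2_ge0. Qed.

Lemma phase_alg_sum1 n T (O : finType) (p : {ffun 'I_n -> bool} -> O -> R) x :
  phase_alg T p -> \sum_w p x w = 1.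
Proof.
case=> S [v0 [U [pos [out [n1 uU e]]]]]; rewrite -(prun_nsq pos x T n1 uU) /nsq.
rewrite (partition_big out predT) //=; apply: eq_bigr => w _; exact: e.
Qed.

Definition comb S K (E : S -> Vec R K) (phi : Vec R S) : Vec R K :=
  fun q => \sum_s phi s * E s q.

Lemma opapp_comb S K (W : Op R K) (E : S -> Vec R K) phi :
  opapp W (comb E phi) = comb (fun s => opapp W (E s)) phi.
Proof.
apply: functional_extensionality => q; rewrite /opapp /comb.
under eq_bigr do rewrite mulr_sumr.
rewrite exchange_big; apply: eq_bigr => s _; rewrite mulr_sumr.
by apply: eq_bigr => k _; rewrite mulrCA.
Qed.

Lemma dot_comb S K (E : S -> Vec R K) phi psi :
  (forall s t, dot (E s) (E t) = (s == t)%:R) -> dot (comb E phi) (comb E psi) = dot phi psi.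
Proof.
move=> oE; rewrite /dot /comb.
transitivity (\sum_q \sum_s \sum_t ((phi s)^* * psi t) * ((E s q)^* * E t q)).
  apply: eq_bigr => q _; rewrite rmorph_sum mulr_suml; apply: eq_bigr => s _.
  by rewrite mulr_sumr; apply: eq_bigr => t _; rewrite rmorphM /= mulrACA.
rewrite exchange_big; apply: eq_bigr => s _; rewrite exchange_big /=.
transitivity (\sum_t (phi s)^* * psi t * (s == t)%:R).
  by apply: eq_bigr => t _; rewrite -mulr_sumr -oE.
by under eq_bigr do rewrite eq_sym; rewrite sum_deltar.
Qed.

Lemma comb_opapp S K (E : S -> Vec R K) (U : Op R S) phi :
  comb E (opapp U phi) = comb (fun t => comb E (fun s => U s t)) phi.
Proof.
apply: functional_extensionality => q; rewrite /opapp /comb.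
under eq_bigr do rewrite mulr_suml.
rewrite exchange_big; apply: eq_bigr => s _; rewrite mulr_sumr.
by apply: eq_bigr => k _; rewrite mulrAC mulrC.
Qed.

Lemma xbit_out n (x : {ffun 'I_n -> bool}) m : (n <= m)%N -> xbit x m = false.
Proof. by move=> nm; rewrite /xbit; case: insubP => // i; rewrite ltnNge nm. Qed.

Lemma xbit_ord n (x : {ffun 'I_n -> bool}) (i : 'I_n) : xbit x i = x i.
Proof. by rewrite /xbit valK. Qed.

Definition bits p (m : nat) : {ffun 'I_p -> bool} := [ffun k => odd (m %/ 2 ^ val k)].

Lemma bitsK p m : (m < 2 ^ p)%N -> bits_val (bits p m) = m.
Proof.
move=> mp; rewrite -[RHS](modn_small mp) /bits_val => {mp}.
under eq_bigr do rewrite ffunE.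
elim: p => [|p IH]; first by rewrite big_ord0 modn1.
rewrite big_ord_recr /= IH expnS mulnC.
set a := (2 ^ p)%N; have a0 : (0 < a)%N by rewrite expn_gt0.
set d := (m %/ a)%N; set r := (m %% a)%N.
have ra : (r < a)%N by rewrite ltn_mod.
rewrite (divn_eq m a) -/d -/r {2}(divn_eq d 2) modn2.
rewrite mulnDl -mulnA [(2 * a)%N]mulnC -addnA modnMDl modn_small.
  by rewrite addnC mulnC.
by rewrite muln2 -addnn; case: odd; rewrite /= ?mul1n ?mul0n ?add0n ?ltn_add2l // ltn_addl.
Qed.

Lemma oracle_delta n p j l (x : {ffun 'I_n -> bool}) (i : {ffun 'I_p -> bool}) b a w :
  opapp (@oracle R n p j l x) (fun q => (q == (i, b, a, w))%:R) =
  (fun q => (q == (i, b (+) xbit x (bits_val i), a, w))%:R).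
Proof. by rewrite opapp_delta; apply: functional_extensionality => -[[[i' b'] a'] w']. Qed.

Lemma sum_delta2 K (a b : K) : \sum_q ((q == a)%:R : C)^* * (q == b)%:R = (a == b)%:R.
Proof.
by under eq_bigr do rewrite rmorph_nat eq_sym; rewrite sum_deltal.
Qed.

Lemma ler_sum_inj (I K : finType) (g : I -> K) (P : pred I) (P' : pred K) (F : K -> R) :
  injective g -> (forall k, 0 <= F k) -> (forall i, P i -> P' (g i)) ->
  \sum_(i | P i) F (g i) <= \sum_(k | P' k) F k.
Proof.
move=> gi F0 PP; rewrite -(big_imset (fun k => F k) (h := g) (A := P)) /=; last by move=> ? ? _ _; apply: gi.
rewrite big_mkcond [leRHS]big_mkcond; apply: ler_sum => k _.
case: imsetP => [[i Pi ->]|_]; first by rewrite PP.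
by case: ifP.
Qed.

(** Embeds an arbitrary finite basis into bit strings whatever its cardinality is; only the number
    of queries counts, not the number of qubits. *)
Definition onehot S (s : S) : {ffun 'I_#|S| -> bool} := [ffun k => k == enum_rank s].

Lemma onehot_inj S : injective (@onehot S).
Proof. by move=> s t /ffunP/(_ (enum_rank s)); rewrite !ffunE eqxx => /esym/eqP/enum_rank_inj. Qed.

Definition rsqrt2 : R := (Num.sqrt 2)^-1.

Lemma rsqrt2_sq : rsqrt2 * rsqrt2 = 2^-1.
Proof. by rewrite -invfM -expr2 sqr_sqrtr. Qed.

Section MinusState.
Variables (S K : finType) (Q : S -> bool -> K).
Hypothesis Qi : forall s t b b', (Q s b == Q t b') = (s == t) && (b == b').

(** The states (|0> + |1>) / sqrt 2 for [c = false] and (|0> - |1>) / sqrt 2 for [c = true]: the two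
    eigenvectors of the bit flip. *)
Definition had_state (c : bool) (s : S) : Vec R K :=
  comb (fun b q => (q == Q s b)%:R) (fun b => rsqrt2%:C * (-1) ^+ (c && b)).

Definition minus_state := had_state true.

Lemma dot_had_state c c' s t :
  dot (had_state c s) (had_state c' t) = ((s == t) && (c == c'))%:R.
Proof.
rewrite /dot /had_state /comb.
case: (eqVneq s t) => [<-|st].
  rewrite -/(dot _ _) dot_comb; last by move=> b b'; rewrite /dot sum_delta2 Qi eqxx.
  rewrite /dot big_bool !rmorphM /= !andbF !andbT !expr0 rmorph1.
  have -> : (rsqrt2%:C)^* = rsqrt2%:C := conjc_real _.
  rewrite !mulrA !(mulrAC _ _ rsqrt2%:C) -rmorphM rsqrt2_sq -!mulrA -mulrDr.
  rewrite fmorphV rmorph_nat rmorph_sign.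
  by case: c; case: c'; rewrite /= ?expr1 ?expr0 ?mulrNN ?mulr1 ?mulN1r ?mul1r ?addNr ?mulr0 // mulVf // (pnatr_eq0 _ 2).
rewrite big1 // => q _; rewrite !big_bool.
case: (eqVneq q (Q s true)) => [->|_]; first by rewrite !Qi (negbTE st) /= !mulr0 addr0 mulr0.
case: (eqVneq q (Q s false)) => [->|_]; first by rewrite !Qi (negbTE st) /= !mulr0 addr0 mulr0.
by rewrite /= !mulr0 addr0 rmorph0 mul0r.
Qed.

Lemma dot_minus_state s t : dot (minus_state s) (minus_state t) = (s == t)%:R.
Proof. by rewrite dot_had_state andbT. Qed.

Lemma minus_stateE s q :
  minus_state s q = rsqrt2%:C * (-1) ^+ (q == Q s true) * ((q == Q s true) || (q == Q s false))%:R.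
Proof.
rewrite /minus_state /had_state /comb big_bool.
case: (eqVneq q (Q s true)) => [->|_]; first by rewrite !Qi !andbF /= mulr0 addr0.
by rewrite /= expr0 mulr0 add0r.
Qed.

Lemma comb_minus_state phi s b :
  comb minus_state phi (Q s b) = (-1) ^+ b * (rsqrt2%:C * phi s).
Proof.
rewrite /comb (bigD1 s) //= big1 ?addr0 => [|t ts]; last first.
  by rewrite minus_stateE !Qi eq_sym (negbTE ts) /= !mulr0.
by rewrite minus_stateE !Qi eqxx; case: b => /=; rewrite mulr1 mulrC -mulrA mulrCA.
Qed.

(** Each amplitude is split into two of squared modulus one half, and the two values of [b] add up
    to the original probability. *)
Lemma minus_state_measure (P : pred S) (P' : pred K) phi :
  (forall s b, P s -> P' (Q s b)) ->
  \sum_(s | P s) amp2 (phi s) <= \sum_(q | P' q) amp2 (comb minus_state phi q).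
Proof.
move=> PP; have gi : injective (fun sb : S * bool => Q sb.1 sb.2).
  by move=> [s b] [s' b'] /eqP; rewrite Qi /= => /andP[/eqP -> /eqP ->].
apply: le_trans (ler_sum_inj (P := fun sb => P sb.1) gi _ _); first last.
- by move=> [s b]; apply: PP.
- by move=> k; apply: amp2_ge0.
rewrite [leRHS](eq_bigl (fun sb => P sb.1 && predT sb.2)) => [|sb]; last by rewrite andbT.
rewrite -(pair_big P predT (fun s b => amp2 (comb minus_state phi (Q s b)))) /=.
apply: ler_sum => s _; rewrite big_bool !comb_minus_state !amp2_sign amp2M amp2_real.
rewrite expr2 rsqrt2_sq /=; lra.
Qed.
End MinusState.

(* A phase query is a bit query whose target qubit is in the state (|0> - |1>) / sqrt 2. *)
Lemma phase_alg_query_computes n (f : pbool_fun n) T (p : {ffun 'I_n -> bool} -> bool -> R) :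
  phase_alg T p -> (forall x v, f x = Some v -> 2 / 3 <= p x v) -> query_computes R f T.
Proof.
case=> S [v0 [U [pos [out [n1 uU ep]]]]] hf.
(* [n] index qubits suffice since [n < 2 ^ n]; all null queries are clipped to the value [n], which
   is still out of range. *)
pose ix t s := bits n (minn n (pos t s)).
pose Q t s b : QSt n 0 #|S| := (ix t s, b, [ffun=> false], onehot s).
have Qi t s s' b b' : (Q t s b == Q t s' b') = (s == s') && (b == b').
  by apply/eqP/andP => [[_ -> /onehot_inj ->]|[/eqP -> /eqP ->]].
pose E t := minus_state (Q t).
have oE t s s' : dot (E t s) (E t s') = (s == s')%:R by apply: dot_minus_state.
have orE (x : {ffun 'I_n -> bool}) t s :
    opapp (@oracle R n n 0 #|S| x) (E t s) = fun q => (-1) ^+ xbit x (pos t s) * E t s q.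
  rewrite /E /minus_state /had_state opapp_comb; apply: functional_extensionality => q.
  rewrite /comb !big_bool !oracle_delta.
  have -> : xbit x (bits_val (ix t s)) = xbit x (pos t s).
    rewrite /ix bitsK; last by rewrite (leq_ltn_trans (geq_minl _ _)) // ltn_expl.
    by rewrite /minn; case: ltnP => // h; rewrite !xbit_out // ltnW.
  rewrite -/(Q t s (true (+) _)) -/(Q t s (false (+) _)).
  case: xbit => /=; last by rewrite mul1r.
  move: (_%:R) (_%:R) => a b; rewrite ?expr0 ?expr1.
  by rewrite mulN1r opprD !mulrN1 mulr1 !mulNr opprK addrC.
have [W0 uW0 eW0] := @unitary_extend R unit _ (fun _ => basis R (qinit n 0 #|S|)) (fun _ => comb (E 0%N) v0)
  (fun _ _ => etrans (sum_delta2 _ _) (congr1 (fun b : bool => b%:R) (eqxx _)))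
  (fun _ _ => etrans (dot_comb _ _ (oE 0%N)) (etrans (esym (nsqE _)) (congr1 (real_complex R) n1))).
(* The embedding [E t] of [S] changes with [t], because the index register must already show the
   next position. [W] therefore applies [U t] and moves from [E t] to [E t.+1] at once. *)
have hW t : exists W : Op R (QSt n 0 #|S|), unitary W /\
    forall s, opapp W (E t s) = comb (E t.+1) (fun s' => U t s' s).
  have [|W uW eW] := @unitary_extend R S _ (E t) (fun s => comb (E t.+1) (fun s' => U t s' s)) (oE t).
    by move=> s s'; rewrite dot_comb //; exact: uU.
  by exists W.
pose W t := proj1_sig (constructive_indefinite_description _ (hW t)).
have WP t := proj2_sig (constructive_indefinite_description _ (hW t)).
pose UU t := if t is t'.+1 then W t' else W0.
have runE (x : {ffun 'I_n -> bool}) t : qrun UU x t = comb (E t) (prun v0 U pos x t).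
  elim: t => [|t IH]; first exact: (eW0 tt).
  rewrite [LHS]/= [prun _ _ _ _ _.+1]/= IH opapp_comb comb_opapp.
  have -> : comb (fun s => opapp (@oracle R n n 0 #|S| x) (E t s)) (prun v0 U pos x t) =
     comb (E t) (fun s => (-1) ^+ xbit x (pos t s) * prun v0 U pos x t s).
    apply: functional_extensionality => q; apply: eq_bigr => s _.
    by rewrite orE mulrCA mulrA.
  rewrite opapp_comb; congr comb; apply: functional_extensionality => s.
  exact: (proj2 (WP t)).
pose dout (q : QSt n 0 #|S|) := if [pick s | onehot s == q.2] is Some s then out s else false.
exists n, 0%N, #|S|, UU, dout; split=> [[|t] _ //|x v fx]; first exact: (proj1 (WP t)).
apply: (le_trans (hf _ _ fx)); rewrite runE ep; apply: minus_state_measure => // s b /eqP <-.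
rewrite /dout; case: pickP => [s' /eqP/onehot_inj ->|/(_ s)]; by rewrite eqxx.
Qed.
End PhaseModel.

(** * Tensor products and closure properties of phase algorithms *)

Section Tensor.
Variable R : realType.
Local Notation C := (R[i]).
Local Notation "x %:C" := (real_complex R x) (format "x %:C") : ring_scope.
Variables (Q S : finType).

Definition tensor_op (U : Q -> Op R S) : Op R {ffun Q -> S} := fun s t => \prod_q U q (s q) (t q).
Definition tensor_vec (v : Q -> Vec R S) : Vec R {ffun Q -> S} := fun s => \prod_q v q (s q).

Lemma opapp_tensor U v : opapp (tensor_op U) (tensor_vec v) = tensor_vec (fun q => opapp (U q) (v q)).
Proof.
apply: functional_extensionality => s; rewrite /opapp /tensor_vec bigA_distr_bigA /=.
by apply: eq_bigr => t _; rewrite -big_split.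
Qed.

Lemma prod_delta (s t : {ffun Q -> S}) : \prod_q ((s q == t q)%:R : C) = (s == t)%:R.
Proof.
case: eqP => [->|st]; first by rewrite big1 // => q _; rewrite eqxx.
case: (pickP (fun q => s q != t q)) => [q /negbTE sq|no]; first by rewrite (bigD1 q) //= sq mul0r.
by case: st; apply/ffunP => q; apply/eqP; move/negbFE: (no q).
Qed.

Lemma unitary_tensor U : (forall q, unitary (U q)) -> unitary (tensor_op U).
Proof.
move=> uU s t; rewrite -prod_delta.
have -> : \prod_q ((s q == t q)%:R : C) = \prod_q \sum_u (U q u (s q))^* * U q u (t q).
  by apply: eq_bigr => q _; rewrite uU.
rewrite bigA_distr_bigA /=; apply: eq_bigr => u _.
by rewrite rmorph_prod -big_split.
Qed.

Lemma nsq_tensor v : nsq (tensor_vec v) = \prod_q nsq (v q).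
Proof.
by rewrite /nsq bigA_distr_bigA /=; apply: eq_bigr => s _; rewrite amp2_prod.
Qed.
End Tensor.

Section Closure.
Variable R : realType.
Local Notation C := (R[i]).
Local Notation "x %:C" := (real_complex R x) (format "x %:C") : ring_scope.
Variable n : nat.
Local Notation input := {ffun 'I_n -> bool}.

Lemma phase_alg_map T (O O' : finType) (p : input -> O -> R) (h : O -> O') :
  phase_alg T p -> phase_alg T (fun x w' => \sum_(w | h w == w') p x w).
Proof.
case=> S [v0 [U [pos [out [n1 uU e]]]]].
exists S, v0, U, pos, (h \o out); split=> // x w'.
under eq_bigr do rewrite e.
rewrite [RHS](partition_big out (fun w => h w == w')) //=.
apply: eq_bigr => w /eqP hw; apply: eq_bigl => s.
by case: (eqVneq (out s) w) => [->|_]; rewrite ?hw ?eqxx ?andbF.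
Qed.

(** The [M] copies are queried one after the other: copy [r] is active during the [T] steps from
    [r * T] on and idle otherwise. At time [tau] it has thus made [minn T (tau - r * T)] steps, with
    truncated subtraction. *)
Lemma phase_alg_power T M (O : finType) (p : input -> O -> R) :
  phase_alg T p -> phase_alg (M * T) (fun x (w : {ffun 'I_M -> O}) => \prod_r p x (w r)).
Proof.
case=> S [v0 [U [pos [out [n1 uU e]]]]].
pose U' tau : Op R {ffun 'I_M -> S} :=
  tensor_op (fun r : 'I_M => if val r == (tau %/ T)%N then U (tau %% T)%N else @idop R S).
pose pos' tau (s : {ffun 'I_M -> S}) :=
  if insub (tau %/ T)%N is Some r then pos (tau %% T)%N (s r) else n.
have uU' tau : unitary (U' tau).
  by apply: unitary_tensor => r; case: ifP => _ //; apply: unitary_id.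
have run (x : input) tau : (tau <= M * T)%N ->
   prun (tensor_vec (fun _ => v0)) U' pos' x tau =
   tensor_vec (fun r : 'I_M => prun v0 U pos x (minn T (tau - r * T)%N)).
  elim: tau => [_|tau IH lt].
    by congr tensor_vec; apply: functional_extensionality => r; rewrite sub0n minn0.
  have T0 : (0 < T)%N by case: (T) lt => //; rewrite muln0.
  rewrite /= IH ?(ltnW lt) //.
  have rM : (tau %/ T < M)%N by rewrite ltn_divLR.
  pose r0 := Ordinal rM.
  have et : tau = (r0 * T + tau %% T)%N by rewrite /= -divn_eq.
  have ut : (tau %% T < T)%N by rewrite ltn_mod.
  have eu : (tau - r0 * T)%N = (tau %% T)%N by rewrite [X in (X - _)%N]et addKn.
  transitivity (opapp (U' tau) (tensor_vec (fun r : 'I_M =>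
    if r == r0 then fun a => (-1) ^+ xbit x (pos (tau %% T)%N a) * prun v0 U pos x (tau %% T)%N a
    else prun v0 U pos x (minn T (tau - r * T))))).
    congr opapp; apply: functional_extensionality => s; rewrite /tensor_vec /pos'.
    rewrite insubT /= -/r0 (bigD1 r0) //= [RHS](bigD1 r0) //= eqxx mulrA.
    congr (_ * _).
      by rewrite eu (minn_idPr (ltnW ut)).
    by apply: eq_bigr => r /negbTE ->.
  rewrite opapp_tensor; congr tensor_vec; apply: functional_extensionality => r.
  have -> : (val r == tau %/ T)%N = (r == r0) by rewrite -val_eqE.
  case: (eqVneq r r0) => [->|rr].
    by rewrite subSn ?[X in (_ <= X)%N]et ?leq_addr // eu (minn_idPr ut).
  rewrite opapp_id; congr prun; case: (ltngtP (val r) (val r0)) => [lr|lr|/val_inj]; last first.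
  - by move/eqP; rewrite (negbTE rr).
  - have h : (tau.+1 <= r * T)%N.
      by rewrite et -addnS (@leq_trans (r0.+1 * T)) ?leq_mul2r ?lr ?orbT // mulSn addnC leq_add2r.
    by rewrite (eqP h) (eqP (ltnW h)).
  - have h : (T <= tau - r * T)%N.
      rewrite leq_subRL; last first.
        by rewrite et (leq_trans _ (leq_addr _ _)) // leq_mul2r ltnW ?orbT.
      by rewrite et (leq_trans _ (leq_addr _ _)) // -mulSnr leq_mul2r lr orbT.
    rewrite (minn_idPl h) (minn_idPl _) // (leq_trans h) // leq_sub2r //.
exists {ffun 'I_M -> S}, (tensor_vec (fun _ => v0)), U', pos', (fun s : {ffun 'I_M -> S} => [ffun r => out (s r)] : {ffun 'I_M -> O}).
split=> // [|x w]; first by rewrite nsq_tensor big1.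
rewrite run //; under eq_bigr do rewrite e.
rewrite (bigA_distr_big_dep (fun (r : 'I_M) s => out s == w r)) /=.
apply: eq_big => [s|s _].
  apply/familyP/eqP => [h|<- r]; last by rewrite unfold_in /= ffunE.
  by apply/ffunP => r; rewrite ffunE; apply/eqP/h.
rewrite amp2_prod; apply: eq_bigr => r _; congr amp2.
have -> : minn T (M * T - r * T) = T; last by [].
by apply/minn_idPl; rewrite -mulnBl leq_pmull // subn_gt0.
Qed.

(** Run both algorithms on the direct sum of their spaces with amplitudes sqrt(lam) and sqrt(1 -
    lam). Block-diagonal evolution prevents interference, so the probabilities mix linearly. *)
Lemma phase_alg_convex T (O : finType) (p1 p2 : input -> O -> R) (lam : R) :
  0 <= lam <= 1 -> phase_alg T p1 -> phase_alg T p2 ->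
  phase_alg T (fun x w => lam * p1 x w + (1 - lam) * p2 x w).
Proof.
move=> /andP[l0 l1] [S1 [v1 [U1 [pos1 [out1 [n1 uU1 e1]]]]]] [S2 [v2 [U2 [pos2 [out2 [n2 uU2 e2]]]]]].
pose a1 : C := (Num.sqrt lam)%:C; pose a2 : C := (Num.sqrt (1 - lam))%:C.
have A1 : amp2 a1 = lam by rewrite amp2_real sqr_sqrtr.
have A2 : amp2 a2 = 1 - lam by rewrite amp2_real sqr_sqrtr // subr_ge0.
pose join (phi1 : Vec R S1) (phi2 : Vec R S2) : Vec R (S1 + S2)%type :=
  fun s => match s with inl s => a1 * phi1 s | inr s => a2 * phi2 s end.
pose U t : Op R (S1 + S2)%type := fun s s' => match s, s' with
  | inl s, inl s' => U1 t s s' | inr s, inr s' => U2 t s s' | _, _ => 0 end.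
pose pos t (s : S1 + S2) := match s with inl s => pos1 t s | inr s => pos2 t s end.
pose out (s : S1 + S2) := match s with inl s => out1 s | inr s => out2 s end.
have run (x : input) t : prun (join v1 v2) U pos x t = join (prun v1 U1 pos1 x t) (prun v2 U2 pos2 x t).
  elim: t => [|t IH] //=; apply: functional_extensionality => s; rewrite IH /opapp big_sumType.
  case: s => s /=.
    rewrite [X in _ + X]big1 => [|u _]; last by rewrite mul0r.
    by rewrite addr0 mulr_sumr; apply: eq_bigr => u _; rewrite [_ * (a1 * _)]mulrCA [LHS]mulrCA.
  rewrite big1 => [|u _]; last by rewrite mul0r.
  by rewrite add0r mulr_sumr; apply: eq_bigr => u _; rewrite [_ * (a2 * _)]mulrCA [LHS]mulrCA.
exists (S1 + S2)%type, (join v1 v2), U, pos, out; split.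
- rewrite /nsq big_sumType /=; under eq_bigr do rewrite amp2M A1.
  under [X in _ + X]eq_bigr do rewrite amp2M A2.
  by rewrite -!mulr_sumr -!/(nsq _) n1 n2 !mulr1 addrC subrK.
- move=> t [s|s] [s'|s'] /=; rewrite big_sumType /=.
  + by rewrite uU1 [X in _ + X]big1 ?addr0 // => u _; rewrite mulr0.
  + by rewrite !big1 ?addr0 // => u _; rewrite ?mulr0 // rmorph0 mul0r.
  + by rewrite !big1 ?addr0 // => u _; rewrite ?mulr0 // rmorph0 mul0r.
  + by rewrite uU2 big1 ?add0r // => u _; rewrite mulr0.
move=> x w; rewrite run big_sumType /= e1 e2 !mulr_sumr.
by congr (_ + _); apply: eq_bigr => s _; rewrite amp2M ?A1 ?A2.
Qed.

End Closure.

(** * Majority voting and minimax *)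

Section Majority.
Variable R : realType.
Variables (Q : finType) (pr : Q -> bool -> R).
Hypothesis pr_ge0 : forall q b, 0 <= pr q b.
Hypothesis pr_sum : forall q, pr q true + pr q false = 1.

Lemma sum_prod_weight (G : Q -> bool -> R) :
  \sum_(o : {ffun Q -> bool}) (\prod_q pr q (o q)) * (\prod_q G q (o q)) =
  \prod_q (pr q true * G q true + pr q false * G q false).
Proof.
under [RHS]eq_bigr do rewrite -(big_bool (GRing.add) (fun b => pr _ b * G _ b)).
by rewrite bigA_distr_bigA /=; apply: eq_bigr => o _; rewrite -big_split.
Qed.

Lemma sum_prod1 : \sum_(o : {ffun Q -> bool}) \prod_q pr q (o q) = 1.
Proof.
transitivity (\sum_(o : {ffun Q -> bool}) (\prod_q pr q (o q)) * (\prod_(q : Q) 1)).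
  by apply: eq_bigr => o _; rewrite big1_eq mulr1.
by rewrite (sum_prod_weight (fun _ _ => 1)) big1 // => q _; rewrite !mulr1.
Qed.

(* Chebyshev's inequality. *)
Lemma majority_error (A : {set Q}) (v : bool) (eps : R) : (0 < #|A|)%N -> 0 < eps ->
  (forall q, q \in A -> 1 / 2 + eps <= pr q v) ->
  \sum_(o : {ffun Q -> bool} | (2 * #|[set q in A | o q == v]| <= #|A|)%N) \prod_q pr q (o q)
    <= (4 * eps ^+ 2 * #|A|%:R)^-1.
Proof.
move=> A0 e0 hA; pose X q b : R := (b == v)%:R - pr q v.
have X0 q : pr q true * X q true + pr q false * X q false = 0.
  by have := pr_sum q; rewrite /X; case: (v) => /= h; nra.
have XV q : pr q true * (X q true * X q true) + pr q false * (X q false * X q false) <= 4^-1.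
  have := pr_sum q; rewrite /X; case: (v) => /= h.
    have -> : pr q false = 1 - pr q true by lra.
    by have := sqr_ge0 (pr q true - 2^-1); nra.
  have -> : pr q true = 1 - pr q false by lra.
  by have := sqr_ge0 (pr q false - 2^-1); nra.
(* Votes are independent and centred. The product of two factors is written as a product over all
   voters, so that [sum_prod_weight] factorises the expectation and a zero factor appears. *)
have cov q q' : q != q' ->
    \sum_(o : {ffun Q -> bool}) (\prod_q pr q (o q)) * (X q (o q) * X q' (o q')) = 0.
  move=> qq; pose G r b := (if r == q then X q b else 1) * (if r == q' then X q' b else 1).
  transitivity (\sum_(o : {ffun Q -> bool}) (\prod_q pr q (o q)) * \prod_r G r (o r)).
    apply: eq_bigr => o _; congr (_ * _); rewrite big_split /=.
    by rewrite -!big_mkcond /= !big_pred1_eq.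
  rewrite sum_prod_weight (bigD1 q) //= /G eqxx (negbTE qq) !mulr1 X0 mul0r //.
have var q : \sum_(o : {ffun Q -> bool}) (\prod_q pr q (o q)) * (X q (o q) * X q (o q)) <= 4^-1.
  pose G r b := (if r == q then X q b * X q b else 1).
  have -> : \sum_(o : {ffun Q -> bool}) (\prod_q pr q (o q)) * (X q (o q) * X q (o q)) =
      \sum_(o : {ffun Q -> bool}) (\prod_q pr q (o q)) * \prod_r G r (o r).
    by apply: eq_bigr => o _; congr (_ * _); rewrite -big_mkcond /= big_pred1_eq.
  rewrite sum_prod_weight (bigD1 q) //= /G eqxx big1 ?mulr1 //.
  by move=> r /negbTE ->; rewrite !mulr1.
have EV : \sum_(o : {ffun Q -> bool}) (\prod_q pr q (o q)) * (\sum_(q in A) X q (o q)) ^+ 2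
    <= #|A|%:R / 4.
  have -> : \sum_(o : {ffun Q -> bool}) (\prod_q pr q (o q)) * (\sum_(q in A) X q (o q)) ^+ 2 =
    \sum_(q in A) \sum_(q' in A) \sum_(o : {ffun Q -> bool}) (\prod_q pr q (o q)) * (X q (o q) * X q' (o q')).
    under [RHS]eq_bigr do rewrite exchange_big /=.
    rewrite [RHS]exchange_big /=; apply: eq_bigr => o _.
    rewrite expr2 mulr_suml mulr_sumr; apply: eq_bigr => q _.
    by rewrite mulr_sumr mulr_sumr.
  rewrite -sum1_card natr_sum mulr_suml; apply: ler_sum => q qA.
  rewrite (bigD1 q) //= [X in _ + X]big1 => [|q' /andP[_ qq]]; last first.
    by apply: cov; rewrite eq_sym.
  by rewrite addr0 mul1r; apply: var.
have A0' : 0 < #|A|%:R :> R by rewrite ltr0n.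
(* Without a strict majority for [v], the centred sum is at most [- eps * #|A|]; with second moment
   at most [#|A| / 4] this gives the bound. *)
have bad (o : {ffun Q -> bool}) : (2 * #|[set q in A | o q == v]| <= #|A|)%N ->
    (eps * #|A|%:R) ^+ 2 <= (\sum_(q in A) X q (o q)) ^+ 2.
  move=> h; have h' : 2 * #|[set q in A | o q == v]|%:R <= #|A|%:R :> R by rewrite -natrM ler_nat.
  have le : \sum_(q in A) X q (o q) <= - (eps * #|A|%:R).
    have -> : \sum_(q in A) X q (o q) = #|[set q in A | o q == v]|%:R - \sum_(q in A) pr q v.
      rewrite sumrB; congr (_ - _); rewrite -sum1dep_card natr_sum big_mkcondr.
      by apply: eq_bigr => q _; case: eqP.
    have : \sum_(q in A) (1 / 2 + eps) <= \sum_(q in A) pr q v by apply: ler_sum.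
    rewrite sumr_const -mulr_natr; nra.
  have : 0 <= eps * #|A|%:R by rewrite mulr_ge0 ?ltW.
  nra.
have w0 (o : {ffun Q -> bool}) : 0 <= \prod_q pr q (o q) by apply: prodr_ge0.
set B := \sum_(o | _) _.
have hB : B * (eps * #|A|%:R) ^+ 2 <= #|A|%:R / 4.
  apply: le_trans EV; rewrite mulr_suml big_mkcond /=; apply: ler_sum => o _.
  case: ifP => h; last by rewrite mulr_ge0 ?sqr_ge0.
  by apply: ler_wpM2l; rewrite ?bad.
have pos4 : 0 < 4 * eps ^+ 2 * #|A|%:R by rewrite !mulr_gt0 ?exprn_gt0.
rewrite -[leRHS]mul1r ler_pdivlMr // -(ler_pM2r A0'); lra.
Qed.
End Majority.

Section Amplify.
Variable R : realType.
Variable n : nat.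
Local Notation input := {ffun 'I_n -> bool}.

(** The condition on [M] says that the Chebyshev error [(4 * eps ^+ 2 * M)^-1] is at most 1/3. *)
Lemma query_computes_amplify (f : pbool_fun n) T M (p : input -> bool -> R) (eps : R) :
  phase_alg T p -> 0 < eps -> (forall x v, f x = Some v -> 1 / 2 + eps <= p x v) ->
  3 <= 4 * eps ^+ 2 * M%:R -> query_computes R f (M * T).
Proof.
move=> pT e0 hf hM.
have M0 : (0 < M)%N by case: (M) hM => //; rewrite mulr0; lra.
(* Ties count as [false]; the non-strict event in [majority_error] covers the wrong answers for both
   values. *)
pose maj (o : {ffun 'I_M -> bool}) := (M < 2 * #|[set q | o q]|)%N.
apply: (phase_alg_query_computes (phase_alg_map maj (phase_alg_power M pT))) => x v fx.
have p0 (q : 'I_M) b : 0 <= p x b := phase_alg_ge0 x b pT.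
have p1 (q : 'I_M) : p x true + p x false = 1.
  by rewrite -(phase_alg_sum1 x pT) big_bool.
have tot := sum_prod1 (pr := fun _ : 'I_M => p x) p1.
rewrite (bigID (fun o => maj o == v)) /= in tot.
have M0' : (0 < #|[set: 'I_M]|)%N by rewrite cardsT card_ord.
have err := majority_error (pr := fun _ : 'I_M => p x) p0 p1 M0' e0 (v := v) (fun q _ => hf x v fx).
have le : (4 * eps ^+ 2 * #|[set: 'I_M]|%:R)^-1 <= 1 / 3 :> R.
  clear p1; rewrite cardsT card_ord -[leLHS]mul1r ler_pdivrMr; lra.
have sub : \sum_(o : {ffun 'I_M -> bool} | maj o != v) \prod_q p x (o q) <=
  \sum_(o : {ffun 'I_M -> bool} | (2 * #|[set q in [set: 'I_M] | o q == v]| <= #|[set: 'I_M]|)%N) \prod_q p x (o q).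
  rewrite big_mkcond [leRHS]big_mkcond; apply: ler_sum => o _.
  have w0 : 0 <= \prod_(q < M) p x (o q) by apply: prodr_ge0 => q _; apply: p0.
  case: ifP => [bad|_]; last by case: ifP.
  rewrite ifT // cardsT card_ord.
  have -> : [set q in [set: 'I_M] | o q == v] = [set q | o q == v] by apply/setP => q; rewrite !inE.
  case: v bad {fx hf err tot} => [|].
    rewrite /maj eqb_id -leqNgt => h; apply: leq_trans h.
    rewrite leq_mul2l /=; apply: subset_leq_card; apply/subsetP => q; rewrite !inE; by case: (o q).
  rewrite /maj eqbF_neg negbK => h.
  have : (#|[set q | o q]| + #|[set q | o q == false]| = M)%N.
    rewrite -[RHS]card_ord -(cardsC [set q | o q]); congr (_ + _)%N.
    by apply: eq_card => q; rewrite !inE eqbF_neg.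
  by move: h; clear; move: #|_| #|_| => a b; lia.
move: tot (le_trans sub (le_trans err le)) => {sub err le p1 p0}.
set a := \sum_(i | maj i == v) _; set b := \sum_(i | _) _ => ab1 b1.
have -> : a = 1 - b by rewrite -ab1 addrK.
by move: b1; clear; move: b => b; lra.
Qed.

(* Each new strategy is a best response to the current positive deficits [d v]; averaging it in makes their squared norm decay like [1/S]. *)
Lemma minimax (X : finType) (cls : (X -> R) -> Prop) (theta eta : R) :
  (exists v, cls v) -> (forall v, cls v -> forall x, 0 <= v x <= 1) ->
  (forall v w lam, 0 <= lam <= 1 -> cls v -> cls w -> cls (fun x => lam * v x + (1 - lam) * w x)) ->
  0 <= theta <= 1 -> 0 < eta ->
  (forall mu : X -> R, (forall x, 0 <= mu x) -> \sum_x mu x = 1 ->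
     exists2 v, cls v & theta <= \sum_x mu x * v x) ->
  exists2 v, cls v & forall x, theta - eta <= v x.
Proof.
move=> [v0 cv0] c01 ccvx /andP[t0 t1] e0 best.
pose d (v : X -> R) x := Num.max 0 (theta - v x).
have d0 v x : 0 <= d v x by rewrite /d le_max lexx.
(* The invariant is the decay rate of the squared deficits; the start [S = 0] holds because every
   deficit is at most 1. *)
have step S : exists2 v, cls v & S.+1%:R * \sum_x (d v x) ^+ 2 <= #|X|%:R.
  elim: S => [|S [v cv IH]].
    exists v0 => //; rewrite mul1r -sum1_card natr_sum; apply: ler_sum => x _.
    have /andP[a b] := c01 _ cv0 x; rewrite /d; case: (leP 0 (theta - v0 x)) => h; nra.
  (* The deficits, normalised to total 1, are the distribution to respond to; if they all vanish,
     [v] itself will do. *)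
  have [w cw hw] : exists2 w, cls w & \sum_x d v x * (theta - w x) <= 0.
    case: (eqVneq (\sum_x d v x) 0) => [z|nz].
      exists v => //; rewrite big1 // => x _.
      by have /psumr_eq0P -> := z; rewrite ?mul0r.
    have Z0 : 0 < \sum_x d v x by rewrite lt_neqAle eq_sym nz sumr_ge0.
    have [||w cw hw] := best (fun x => d v x / \sum_x d v x).
    - by move=> x; rewrite divr_ge0 // ltW.
    - by rewrite -mulr_suml divff.
    exists w => //.
    have e : \sum_x d v x / (\sum_x d v x) * w x = (\sum_x d v x * w x) / \sum_x d v x.
      by rewrite mulr_suml; apply: eq_bigr => x _; rewrite mulrAC.
    move: hw; rewrite e ler_pdivlMr // => hw.
    under eq_bigr do rewrite mulrBr.
    rewrite sumrB -mulr_suml; lra.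
  (* Weights of a running average of [S.+2] strategies. After multiplication by [S.+2] and squaring,
     the cross term is nonpositive by [hw], and the square of the new term is at most 1. *)
  pose lam : R := S.+1%:R / S.+2%:R.
  have S2 : 0 < S.+2%:R :> R by rewrite ltr0n.
  have lamE : lam * S.+2%:R = S.+1%:R by rewrite /lam divfK // lt0r_neq0.
  have S12 : S.+2%:R = S.+1%:R + 1 :> R by rewrite -natr1.
  have S1 : 0 < S.+1%:R :> R by rewrite ltr0n.
  have lam01 : 0 <= lam <= 1.
    apply/andP; split; first by rewrite divr_ge0 // ltW.
    by rewrite ler_pdivrMr // mul1r ler_nat.
  clearbody lam; pose u x := lam * v x + (1 - lam) * w x.
  exists u; first exact: ccvx.
  have pt x : (S.+2%:R * d u x) ^+ 2 <= S.+1%:R ^+ 2 * d v x ^+ 2 + 2 * S.+1%:R * (d v x * (theta - w x)) + 1.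
    have /andP[a b] := c01 _ cw x.
    have -> : S.+2%:R * d u x = Num.max 0 (S.+1%:R * (theta - v x) + (theta - w x)).
      rewrite /d maxr_pMr ?ltW // mulr0; congr Num.max; rewrite /u.
      have -> : theta - (lam * v x + (1 - lam) * w x) = lam * (theta - v x) + (1 - lam) * (theta - w x) by ring.
      rewrite mulrDr !mulrA ![S.+2%:R * lam]mulrC lamE; congr (_ + _).
      by rewrite [_ * (1 - lam)]mulrBr mulr1 [S.+2%:R * lam]mulrC lamE S12 addrC addKr mul1r.
    have h1 : theta - v x <= d v x by rewrite /d le_max lexx orbT.
    have h2 := d0 v x.
    have h3 : (theta - w x) ^+ 2 <= 1 by nra.
    have h4 : S.+1%:R * (theta - v x) <= S.+1%:R * d v x by rewrite ler_wpM2l // ltW.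
    have -> : S.+1%:R ^+ 2 * d v x ^+ 2 + 2 * S.+1%:R * (d v x * (theta - w x)) + 1 =
      (S.+1%:R * d v x + (theta - w x)) ^+ 2 + (1 - (theta - w x) ^+ 2) by ring.
    case: (leP 0 (S.+1%:R * (theta - v x) + (theta - w x))) => h; last first.
      by rewrite expr0n addr_ge0 ?sqr_ge0 // subr_ge0.
    have : (S.+1%:R * (theta - v x) + (theta - w x)) ^+ 2 <= (S.+1%:R * d v x + (theta - w x)) ^+ 2.
      by rewrite ler_sqr ?nnegrE //; lra.
    lra.
  have sum : S.+2%:R ^+ 2 * \sum_x d u x ^+ 2 <= S.+1%:R ^+ 2 * (\sum_x d v x ^+ 2) + #|X|%:R.
    have -> : #|X|%:R = \sum_(x : X) 1 :> R by rewrite -sum1_card natr_sum.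
    apply: (@le_trans _ _ (\sum_x (S.+1%:R ^+ 2 * d v x ^+ 2 + 2 * S.+1%:R * (d v x * (theta - w x)) + 1))).
      by rewrite mulr_sumr; apply: ler_sum => x _; rewrite -exprMn.
    rewrite !big_split /= -!mulr_sumr.
    have : 2 * S.+1%:R * (\sum_x d v x * (theta - w x)) <= 0.
      by rewrite mulr_ge0_le0 // mulr_ge0 // ltW.
    lra.
  set D := \sum_x d u x ^+ 2 in sum *; set D' := \sum_x d v x ^+ 2 in sum IH.
  rewrite -(ler_pM2l S2) mulrA -expr2; apply: le_trans sum _.
  by rewrite S12 mulrDl mul1r lerD2r expr2 -mulrA ler_pM2l.
have [S hS] : exists S, #|X|%:R <= S.+1%:R * eta ^+ 2.
  exists (Num.truncn (#|X|%:R / eta ^+ 2)).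
  by rewrite -ler_pdivrMr ?exprn_gt0 // ltW // truncnS_gt // divr_ge0 ?sqr_ge0.
have [v cv hv] := step S; exists v => // x.
have h : (d v x) ^+ 2 <= \sum_x (d v x) ^+ 2.
  by rewrite (bigD1 x) //= lerDl sumr_ge0 // => y _; rewrite sqr_ge0.
have : (d v x) ^+ 2 <= eta ^+ 2.
  have S1 : 0 < S.+1%:R :> R by rewrite ltr0n.
  rewrite -(ler_pM2l S1); apply: le_trans hS; apply: le_trans hv.
  by rewrite ler_pM2l.
have e0' := ltW e0; rewrite ler_sqr ?nnegrE // => h'.
have : theta - v x <= d v x by rewrite /d le_max lexx orbT.
lra.
Qed.

Lemma query_computes_of_average (f : pbool_fun n) T M (X : finType) (inp : X -> input) (val : X -> bool) (eps : R) :
  (forall x v, f x = Some v -> exists2 q, inp q = x & val q = v) ->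
  0 < eps <= 1 / 2 -> 3 <= eps ^+ 2 * M%:R ->
  (exists p : input -> bool -> R, phase_alg T p) ->
  (forall mu : X -> R, (forall x, 0 <= mu x) -> \sum_x mu x = 1 ->
     exists2 p : input -> bool -> R, phase_alg T p & 1 / 2 + eps <= \sum_x mu x * p (inp x) (val x)) ->
  query_computes R f (M * T).
Proof.
move=> hX /andP[e0 e1] hM [p0 cp0] best.
pose cls (v : X -> R) := exists2 p : input -> bool -> R, phase_alg T p & v = fun x => p (inp x) (val x).
have [||||||v [p cp ->] hv] := @minimax X cls (1 / 2 + eps) (eps / 2).
- by exists (fun x => p0 (inp x) (val x)), p0.
- move=> v [p cp ->] x; have := phase_alg_sum1 (inp x) cp; rewrite big_bool /=.
  have := phase_alg_ge0 (inp x) true cp; have := phase_alg_ge0 (inp x) false cp.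
  by case: (val x); lra.
- move=> v w lam l01 [p cp ->] [p' cp' ->].
  by exists (fun x w => lam * p x w + (1 - lam) * p' x w) => //; apply: phase_alg_convex.
- lra.
- lra.
- move=> mu mu0 mu1; have [p cp hp] := best mu mu0 mu1.
  by exists (fun x => p (inp x) (val x)) => //; exists p.
apply: (query_computes_amplify cp (eps := eps / 2)); first lra.
  by move=> x b fx; have [q <- <-] := hX _ _ fx; have := hv q; lra.
have -> : 4 * (eps / 2) ^+ 2 * M%:R = eps ^+ 2 * M%:R by field.
exact: hM.
Qed.
End Amplify.

(** * From bit queries to phase queries *)

Section BitToPhase.
Variable R : realType.
Local Notation C := (R[i]).
Local Notation "x %:C" := (real_complex R x) (format "x %:C") : ring_scope.

Definition adj (S : finType) (W : Op R S) : Op R S := fun s t => (W t s)^*.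

Lemma unitary_adj (S : finType) (W : Op R S) : unitary W -> unitary (adj W).
Proof.
move=> uW s t; rewrite -(unitary_row s t uW); apply: eq_bigr => u _.
by rewrite /adj conjCK.
Qed.

Lemma opapp_adjK (S : finType) (W : Op R S) (v : Vec R S) : unitary W -> opapp W (opapp (adj W) v) = v.
Proof.
move=> uW; rewrite -opapp_mul; apply: functional_extensionality => s.
rewrite /opapp /opmul /adj; under eq_bigr do rewrite (unitary_row _ _ uW).
exact: sum_deltal.
Qed.

(** Here the query qubit is read in the Hadamard basis: [true] is the state that picks up the sign,
    [false] the one that the oracle fixes, hence the null position [n]. *)
Definition std_pos n p j l (s : QSt p j l) : nat := if s.1.1.2 then bits_val s.1.1.1 else n.

(* The query qubit is rewritten in the eigenbasis (|0> +- |1>) / sqrt 2 of the bit flip. *)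
Definition had_basis p j l (s : QSt p j l) : Vec R (QSt p j l) :=
  had_state R (fun (e : {ffun 'I_p -> bool} * ({ffun 'I_j -> bool} * {ffun 'I_l -> bool})) b =>
    (e.1, b, e.2.1, e.2.2) : QSt p j l) s.1.1.2 (s.1.1.1, (s.1.2, s.2)).

Lemma dot_had_basis p j l (s t : QSt p j l) : dot (had_basis s) (had_basis t) = (s == t)%:R.
Proof.
rewrite dot_had_state.
  case: s t => [[[i b] a] w] [[[i' b'] a'] w'] /=.
  congr (_%:R); congr nat_of_bool; rewrite !xpair_eqE.
  by case: (i == i'); case: (a == a'); case: (b == b'); case: (w == w').
move=> [i [a w]] [i' [a' w']] b b' /=; rewrite !xpair_eqE.
by case: (i == i'); case: (a == a'); case: (b == b'); case: (w == w').
Qed.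

Lemma oracle_had_basis n p j l (x : {ffun 'I_n -> bool}) (s : QSt p j l) :
  opapp (@oracle R n p j l x) (had_basis s) =
  fun q => (-1) ^+ xbit x (std_pos n s) * had_basis s q.
Proof.
rewrite /had_basis /had_state opapp_comb; apply: functional_extensionality => q.
case: s => [[[i c] a] w] /=.
rewrite /comb !big_bool /= !oracle_delta /std_pos /= !andbT !andbF.
case: c => /=; last first.
  by rewrite (xbit_out x (leqnn n)) /= expr0 mul1r; case: xbit => //=; rewrite addrC.
case: xbit => /=; last by rewrite mul1r.
move: (_%:R) (_%:R) => u v; rewrite ?expr0 ?expr1.
by rewrite mulN1r opprD !mulrN1 mulr1 !mulNr opprK addrC.
Qed.

Lemma qrun_phase p j l (U : nat -> Op R (QSt p j l)) T : (forall t, (t <= T)%N -> unitary (U t)) ->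
  exists (v0 : Vec R (QSt p j l)) (U' : nat -> Op R (QSt p j l)) (W : Op R (QSt p j l)),
    [/\ nsq v0 = 1, forall t, unitary (U' t), unitary W &
        forall n (x : {ffun 'I_n -> bool}) t, (t <= T)%N ->
          qrun U x t = opapp W (prun v0 U' (fun _ => @std_pos n p j l) x t)].
Proof.
move=> uU; pose W : Op R (QSt p j l) := fun q s => had_basis s q.
have uW : unitary W by move=> s t; rewrite -dot_had_basis.
have WE phi : opapp W phi = comb (@had_basis p j l) phi.
  by apply: functional_extensionality => q; apply: eq_bigr => s _; rewrite mulrC.
(* Step [t] of the phase model contains the unitary that follows query [t], hence [U t.+1]. Beyond
   [T] nothing is known about [U], and the identity keeps [U'] unitary. *)
pose U' t := if (t < T)%N then opmul (adj W) (opmul (U t.+1) W) else @idop R _.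
exists (opapp (adj W) (opapp (U 0%N) (basis R (qinit p j l)))), U', W; split=> //.
- have uWd := unitary_adj uW; rewrite unitary_nsq // unitary_nsq; last exact: uU.
  by rewrite nsq_Re /dot /basis sum_delta2 eqxx.
- move=> t; rewrite /U'; case: ltnP => h; last exact: unitary_id.
  by apply: unitary_mul; [exact: unitary_adj | apply: unitary_mul => //; apply: uU].
move=> n x; elim=> [|t IH] tT /=; first by rewrite opapp_adjK.
rewrite IH ?(ltnW tT) // /U' tT !opapp_mul opapp_adjK //; congr opapp.
rewrite !WE opapp_comb; apply: functional_extensionality => q; apply: eq_bigr => s _.
by rewrite oracle_had_basis mulrCA mulrA.
Qed.
End BitToPhase.

(** * Hard-wiring of inputs and the hybrid argument *)

Section Substitution.
Variable R : realType.
Local Notation C := (R[i]).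

(** If each bit of a long input is a constant xor at most one bit of [x], a query to it is a query
    to [x] times a fixed sign. The result may be measured early, at time [t0], and is padded to [T]
    queries. *)
Lemma phase_alg_substitute n n' (S : finType) (v0 : Vec R S) U pos t0 T
    (io : {ffun 'I_n -> bool} -> {ffun 'I_n' -> bool}) (c : nat -> bool) (q : nat -> nat)
    (O : finType) (out : S -> O) :
  nsq v0 = 1 -> (forall t, unitary (U t)) -> (t0 <= T)%N ->
  (forall x m, xbit (io x) m = c m (+) xbit x (q m)) ->
  phase_alg T (fun x o => \sum_(s | out s == o) amp2 (prun v0 U pos (io x) t0 s)).
Proof.
move=> n1 uU tT hio.
(* The sign of the constant [c] is absorbed into the next unitary; after [t0] only queries followed
   by the identity remain, and these do not change any probability. *)
pose U' t : Op R S := if (t < t0)%N then fun s s' => U t s s' * (-1) ^+ c (pos t s') else @idop R S.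
exists S, v0, U', (fun t s => q (pos t s)), out; split=> // [t s s'|x o].
  rewrite /U'; case: ltnP => _; last exact: unitary_id.
  transitivity (((-1) ^+ c (pos t s) * (-1) ^+ c (pos t s')) * \sum_u (U t u s)^* * U t u s').
    rewrite mulr_sumr; apply: eq_bigr => u _; rewrite rmorphM rmorph_sign /=.
    by rewrite mulrACA mulrC.
  rewrite uU; case: eqP => [->|_]; last by rewrite mulr0.
  by rewrite -expr2 sqrr_sign mulr1.
have run t : (t <= t0)%N -> prun v0 U' (fun t s => q (pos t s)) x t = prun v0 U pos (io x) t.
  elim: t => [|t IH] // lt; rewrite /= IH ?(ltnW lt) // /U' lt.
  apply: functional_extensionality => s; apply: eq_bigr => u _.
  by rewrite hio signr_addb -!mulrA.
apply: eq_bigr => s _; rewrite -(subnKC tT).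
elim: (T - t0)%N => [|d IH]; first by rewrite addn0 run.
rewrite IH addnS /=.
have -> : U' (t0 + d)%N = @idop R S by rewrite /U' ltnNge leq_addr.
by rewrite opapp_id amp2_sign.
Qed.

Definition query_weight n (S : finType) (v0 : Vec R S) U pos (x : {ffun 'I_n -> bool}) t (P : pred nat) : R :=
  \sum_(s | P (pos t s)) amp2 (prun v0 U pos x t s).

(* One query to two inputs that differ at position [c] only rotates the part of the states that queries [c]. *)
Lemma phase_hybrid n (S : finType) (v0 : Vec R S) U pos (x y : {ffun 'I_n -> bool}) c T :
  nsq v0 = 1 -> (forall t, unitary (U t)) ->
  (forall m, m != c -> xbit x m = xbit y m) ->
  1 - complex.Re (dot (prun v0 U pos x T) (prun v0 U pos y T)) <=
  \sum_(t < T) (query_weight v0 U pos x t (pred1 c) + query_weight v0 U pos y t (pred1 c)).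
Proof.
move=> n1 uU hxy; elim: T => [|T IH].
  by rewrite big_ord0 /= -nsq_Re n1 subrr.
rewrite big_ord_recr /= unitary_dot //.
set phi := prun v0 U pos x T in IH *; set psi := prun v0 U pos y T in IH *.
set wx := query_weight _ _ _ x T _; set wy := query_weight _ _ _ y T _.
suff : complex.Re (dot phi psi) - (wx + wy) <=
   complex.Re (dot (fun s => (-1) ^+ xbit x (pos T s) * phi s) (fun s => (-1) ^+ xbit y (pos T s) * psi s)).
  by move: IH; lra.
rewrite /wx /wy /query_weight -big_split /= !Re_sum [X in _ - X]big_mkcond -sumrB.
apply: ler_sum => s _; rewrite -/phi -/psi rmorphM rmorph_sign /= mulrACA -signr_addb.
case: eqP => [_|/eqP/hxy ->]; last by rewrite addbb mul1r subr0.
have h1 := @Re_mul_le R 1 (phi s) (psi s) ltr01; rewrite invr1 !mul1r in h1.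
have := amp2_ge0 (phi s); have := amp2_ge0 (psi s).
case: (_ (+) _); rewrite /= ?expr1 ?mulN1r ?ReN ?expr0 ?mul1r; lra.
Qed.
End Substitution.

(** * The lookup function *)

Section Lookup.
Variables (n k m : nat).
Local Notation input := {ffun 'I_n -> bool}.
Local Notation addr := {ffun 'I_k -> bool}.

Definition cell : finType := (('I_k * 'I_n) + (addr * 'I_m))%type.

Definition lookup_block (y : {ffun 'I_#|cell| -> bool}) (j : 'I_k) : input :=
  [ffun i => y (enum_rank (inl (j, i) : cell))].

Definition lookup_cell (y : {ffun 'I_#|cell| -> bool}) (a : addr) (i : 'I_m) : bool :=
  y (enum_rank (inr (a, i) : cell)).

(** Only the [k] instances carry a promise. The array is unrestricted, so flipping any of its bits
    stays inside the domain. *)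
Definition lookup_fun (f : pbool_fun n) : pbool_fun #|cell| := fun y =>
  if [forall j, f (lookup_block y j) != None]
  then Some (\big[addb/false]_(i < m) lookup_cell y [ffun j => f (lookup_block y j) == Some true] i)
  else None.

Definition lookup_input (x : 'I_k -> input) (Y : {ffun addr * 'I_m -> bool}) : {ffun 'I_#|cell| -> bool} :=
  [ffun c => match enum_val c with inl ji => x ji.1 ji.2 | inr ai => Y ai end].

Lemma lookup_funE f x (v : addr) Y : (forall j, f (x j) = Some (v j)) ->
  lookup_fun f (lookup_input x Y) = Some (\big[addb/false]_(i < m) Y (v, i)).
Proof.
move=> fx; have bE j : lookup_block (lookup_input x Y) j = x j.
  by apply/ffunP => i; rewrite !ffunE enum_rankK.
have aE : [ffun j => f (lookup_block (lookup_input x Y) j) == Some true] = v.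
  by apply/ffunP => j; rewrite ffunE bE fx; case: (v j).
rewrite /lookup_fun aE ifT; last by apply/forallP => j; rewrite bE fx.
by congr Some; apply: eq_bigr => i _; rewrite /lookup_cell ffunE enum_rankK.
Qed.

Definition flip_cell (Y : {ffun addr * 'I_m -> bool}) c : {ffun addr * 'I_m -> bool} :=
  [ffun c' => (c' == c) (+) Y c'].

Lemma flip_cellK c : involutive (flip_cell^~ c).
Proof. by move=> Y; apply/ffunP => c'; rewrite !ffunE addbA addbb. Qed.

Lemma parity_flip Y (v : addr) (i0 : 'I_m) :
  \big[addb/false]_(i < m) flip_cell Y (v, i0) (v, i) = ~~ \big[addb/false]_(i < m) Y (v, i).
Proof.
under eq_bigr do rewrite ffunE xpair_eqE eqxx /=.
rewrite big_split /= (bigD1 i0) //= eqxx big1 ?addbF //.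
by move=> i /negbTE ->.
Qed.

Lemma xbit_flip x Y (c : addr * 'I_m) q : q != enum_rank (inr c : cell) :> nat ->
  xbit (lookup_input x Y) q = xbit (lookup_input x (flip_cell Y c)) q.
Proof.
rewrite /xbit; case: insubP => // r _ <- rc; rewrite !ffunE.
case E : (enum_val r) => [//|c']; rewrite ffunE.
case: eqP => // cc; case/eqP: rc; congr val; apply: enum_val_inj.
by rewrite enum_rankK E cc.
Qed.

Definition addr_of (q : nat) : option addr :=
  if insub q is Some r then (if enum_val (r : 'I_#|cell|) is inr ai then Some ai.1 else None) else None.

Lemma addr_of_rank a i : addr_of (enum_rank (inr (a, i) : cell)) = Some a.
Proof. by rewrite /addr_of valK enum_rankK. Qed.

Lemma addr_ofP q a : addr_of q = Some a -> exists i, q = enum_rank (inr (a, i) : cell).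
Proof.
rewrite /addr_of; case: insubP => // r _ <-.
case E : (enum_val r) => [//|[a' i]] [<-]; exists i; congr val; apply: enum_val_inj.
by rewrite enum_rankK E.
Qed.
End Lookup.

(** * Bound on the chance that a query reveals the address *)

Section DirectProduct.
Variable R : realType.
Variables (n k m : nat).
Local Notation input := {ffun 'I_n -> bool}.
Local Notation addr := {ffun 'I_k -> bool}.
Local Notation cell := (cell n k m).
Variables (X : finType) (inp : X -> input) (val : X -> bool) (mu : X -> R).
Variables (T : nat) (eps : R).
Hypothesis mu_ge0 : forall x, 0 <= mu x.
Hypothesis mu_sum : \sum_x mu x = 1.
Hypothesis hard : forall p : input -> bool -> R, phase_alg T p ->
  \sum_x mu x * p (inp x) (val x) <= 1 / 2 + eps.

Lemma weight_sum : \sum_(xb : {ffun 'I_k -> X}) \prod_j mu (xb j) = 1.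
Proof.
have := bigA_distr_bigA (fun (j : 'I_k) x => mu x) => /= <-.
by rewrite big1 // => j _; exact: mu_sum.
Qed.

Definition upd (xb : {ffun 'I_k -> X}) i z : {ffun 'I_k -> X} := [ffun j => if j == i then z else xb j].

(** Swapping coordinate [i] with an independent sample [z] is an involution that preserves the
    product weight. *)
Lemma resample (i : 'I_k) (G : {ffun 'I_k -> X} -> R) :
  \sum_(xb : {ffun 'I_k -> X}) (\prod_j mu (xb j)) * G xb = \sum_(xb : {ffun 'I_k -> X}) (\prod_j mu (xb j)) * \sum_z mu z * G (upd xb i z).
Proof.
under [RHS]eq_bigr do rewrite mulr_sumr.
rewrite pair_big /=.
pose h (q : {ffun 'I_k -> X} * X) := (upd q.1 i q.2, q.1 i).
have hK : involutive h.
  move=> [xb z]; rewrite /h /=; congr (_, _); last by rewrite ffunE eqxx.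
  by apply/ffunP => j; rewrite !ffunE; case: eqP => [->|].
rewrite (reindex_inj (inv_inj hK)) /=.
transitivity (\sum_(xb : {ffun 'I_k -> X}) \sum_z (\prod_j mu (xb j)) * (mu z * G xb)).
  apply: eq_bigr => xb _; under [RHS]eq_bigr do rewrite mulrCA.
  by rewrite -mulr_suml mu_sum mul1r.
rewrite pair_big /=; apply: eq_bigr => -[xb z] _ /=.
have -> : upd (upd xb i z) i (xb i) = xb by have := hK (xb, z); rewrite /h /= => -[].
rewrite !mulrA; congr (_ * _).
rewrite (bigD1 i) //= [in RHS](bigD1 i) //= !ffunE eqxx.
have -> : \prod_(j < k | j != i) mu (upd xb i z j) = \prod_(j < k | j != i) mu (xb j).
  by apply: eq_bigr => j /negbTE ji; rewrite ffunE ji.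
by rewrite mulrC mulrA [RHS]mulrAC.
Qed.

Variables (S : finType) (v0 : Vec R S) (U : nat -> Op R S) (pos : nat -> S -> nat).
Hypothesis v0_unit : nsq v0 = 1.
Hypothesis uU : forall t, unitary (U t).
Variables (Y : {ffun addr * 'I_m -> bool}) (t : nat).
Hypothesis tT : (t <= T)%N.

Definition agree i (xb : {ffun 'I_k -> X}) (o : option addr) : bool :=
  if o is Some a then [forall j : 'I_k, (j < i)%N ==> (a j == val (xb j))] else false.

Lemma agree_upd (i : 'I_k) xb z o : agree i (upd xb i z) o = agree i xb o.
Proof.
case: o => //= a; apply: eq_forallb => j; case: ltnP => //= ji.
rewrite ffunE; case: (eqVneq j i) => // e; by move: ji; rewrite e ltnn.
Qed.

Lemma agreeS (i : 'I_k) xb o :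
  agree i.+1 xb o = agree i xb o && (if o is Some a then a i == val (xb i) else false).
Proof.
case: o => //= a; apply/forallP/andP => [h|[/forallP h hi] j].
  split; last by have := h i; rewrite ltnSn.
  by apply/forallP => j; apply/implyP => ji; have := h j; rewrite ltnS (ltnW ji).
apply/implyP; rewrite ltnS leq_eqVlt => /orP[/eqP/val_inj -> //|ji].
by have := h j; rewrite ji.
Qed.

Definition hit (i : nat) (xb : {ffun 'I_k -> X}) : R :=
  query_weight v0 U pos (lookup_input (fun j => inp (xb j)) Y) t (fun q => agree i xb (@addr_of n k m q)).

(* Answer with bit [i] of the measured address if its first [i] bits are correct and with a fixed guess otherwise; the recursion is the average over both guesses. *)
Lemma hit_step (i : 'I_k) xb :
  \sum_z mu z * hit i.+1 (upd xb i z) <= (\sum_z mu z * hit i (upd xb i z)) / 2 + eps.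
Proof.
(* All instances but the [i]-th, and the array, are hard-wired; this is a substitution because the
   array does not depend on the instances. *)
pose io (x : input) := lookup_input (fun j => if j == i then x else inp (xb j)) Y.
have ioE z : lookup_input (fun j => inp (upd xb i z j)) Y = io (inp z).
  by congr lookup_input; apply: functional_extensionality => j; rewrite ffunE; case: eqP.
pose out b (s : S) : bool := if @addr_of n k m (pos t s) is Some a
  then (if agree i xb (Some a) then a i else b) else b.
pose p b (x : input) o := \sum_(s | out b s == o) amp2 (prun v0 U pos (io x) t s).
have pT b : phase_alg T (p b).
  pose cq (q : nat) := if insub q is Some r then match enum_val (r : 'I_#|cell|) with
    | inl ji => if ji.1 == i then (false, nat_of_ord ji.2) else (inp (xb ji.1) ji.2, n)
    | inr ai => (Y ai, n) end else (false, n).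
  apply: (@phase_alg_substitute R n _ S v0 U pos t T io (fun q => (cq q).1) (fun q => (cq q).2) _ (out b)) => //.
  move=> x q; rewrite {1}/xbit /cq; case: insubP => [r _ _|_]; last by rewrite xbit_out.
  rewrite ffunE; case: (enum_val r) => [[j i']|ai] /=; last by rewrite xbit_out // addbF.
  by case: ifP => _; rewrite ?xbit_ord ?xbit_out // addbF.
(* If the prefix is wrong, exactly one of the two guesses is right and the outcome counts once; if
   it is right, the outcome counts twice or not at all, according to bit [i]. *)
have key z : p true (inp z) (val z) + p false (inp z) (val z) =
    2 * hit i.+1 (upd xb i z) + (1 - hit i (upd xb i z)).
  rewrite /hit /query_weight ioE /p.
  have tot : \sum_s amp2 (prun v0 U pos (io (inp z)) t s) = 1 by apply: prun_nsq.
  rewrite -[X in _ + (X - _)]tot.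
  rewrite [X in X + _]big_mkcond [X in _ + X]big_mkcond /=.
  rewrite [X in _ = 2 * X + _]big_mkcond [X in _ = _ + (_ - X)]big_mkcond /=.
  rewrite mulr_sumr -sumrB -!big_split /=; apply: eq_bigr => s _.
  rewrite agreeS agree_upd /out; case: addr_of => [a|] /=; last first.
    by case: (val z); rewrite ?addr0 ?add0r ?subr0 mulr0 add0r.
  rewrite ffunE eqxx; case: [forall _, _]; last first.
    by case: (val z); rewrite /= ?addr0 ?add0r ?subr0 mulr0 add0r.
  by case: eqP => _; rewrite /= ?subrr ?mulr0 ?addr0 // mulr_natl mulr2n.
have h1 := hard (pT true); have h2 := hard (pT false).
have : \sum_z mu z * (p true (inp z) (val z) + p false (inp z) (val z)) <= 1 + 2 * eps.
  by under eq_bigr do rewrite mulrDr; rewrite big_split /=; lra.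
have -> : \sum_z mu z * (p true (inp z) (val z) + p false (inp z) (val z)) =
   2 * (\sum_z mu z * hit i.+1 (upd xb i z)) + (1 - \sum_z mu z * hit i (upd xb i z)).
  rewrite -[X in _ + (X - _)]mu_sum mulr_sumr -sumrB -big_split /=; apply: eq_bigr => z _.
  by rewrite key; ring.
lra.
Qed.

Lemma prod_mu_ge0 (xb : {ffun 'I_k -> X}) : 0 <= \prod_j mu (xb j).
Proof. by apply: prodr_ge0. Qed.

(** The fixed point of [a -> a / 2 + eps] is [2 * eps], and the distance to it halves with each
    address bit. *)
Lemma hit_average (i : nat) : 0 <= eps -> (i <= k)%N ->
  \sum_(xb : {ffun 'I_k -> X}) (\prod_j mu (xb j)) * hit i xb <= 2^-1 ^+ i + 2 * eps.
Proof.
move=> e0; elim: i => [_|i IH ik].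
  apply: (@le_trans _ _ 1); last by rewrite expr0; lra.
  rewrite -[leRHS]weight_sum; apply: ler_sum => xb _.
  rewrite -[leRHS]mulr1; apply: ler_wpM2l; first exact: prod_mu_ge0.
  rewrite -[leRHS](prun_nsq pos (lookup_input (fun j => inp (xb j)) Y) t v0_unit uU).
  rewrite /hit /query_weight big_mkcond; apply: ler_sum => s _.
  by case: ifP => // _; apply: amp2_ge0.
have {}IH := IH (ltnW ik).
rewrite (resample (Ordinal ik)).
apply: (@le_trans _ _ (\sum_(xb : {ffun 'I_k -> X}) (\prod_j mu (xb j)) *
   ((\sum_z mu z * hit i (upd xb (Ordinal ik) z)) / 2 + eps))).
  apply: ler_sum => xb _; apply: ler_wpM2l; first exact: prod_mu_ge0.
  exact: (hit_step (Ordinal ik)).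
have -> : \sum_(xb : {ffun 'I_k -> X}) (\prod_j mu (xb j)) *
   ((\sum_z mu z * hit i (upd xb (Ordinal ik) z)) / 2 + eps) =
   (\sum_(xb : {ffun 'I_k -> X}) (\prod_j mu (xb j)) * hit i xb) / 2 + eps.
  rewrite (resample (Ordinal ik) (hit i)).
  under eq_bigr do rewrite mulrDr mulrA.
  by rewrite big_split /= -!mulr_suml weight_sum mul1r.
rewrite exprSr; lra.
Qed.
End DirectProduct.

(** * Query weight forced on the addressed block *)

Section Separation.
Variable R : realType.

(** The trace distance drops by 1/3 between inputs of opposite value, so at least one of the two
    final pure states must move. The last two unitaries cancel in the inner products. *)
Lemma szk_separation N (g : pbool_fun N) j p1 l1 T1 p2 l2 T2
    (U1 : nat -> Op R (QSt p1 j l1)) (U2 : nat -> Op R (QSt p2 j l2))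
    (v1 : Vec R (QSt p1 j l1)) U1' W1 pos1 (v2 : Vec R (QSt p2 j l2)) U2' W2 pos2
    (y y' : {ffun 'I_N -> bool}) b :
  nsq v1 = 1 -> (forall t, unitary (U1' t)) -> unitary W1 ->
  nsq v2 = 1 -> (forall t, unitary (U2' t)) -> unitary W2 ->
  (forall x : {ffun 'I_N -> bool}, qrun U1 x T1 = opapp W1 (prun v1 U1' pos1 x T1)) ->
  (forall x : {ffun 'I_N -> bool}, qrun U2 x T2 = opapp W2 (prun v2 U2' pos2 x T2)) ->
  (forall x v, g x = Some v ->
     let d := trdist (reduced (qrun U1 x T1)) (reduced (qrun U2 x T2)) in
          (v = true -> 2 / 3 <= d) /\ (v = false -> d <= 1 / 3)) ->
  g y = Some b -> g y' = Some (~~ b) ->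
  1 / 36 <= (1 - complex.Re (dot (prun v1 U1' pos1 y T1) (prun v1 U1' pos1 y' T1)))
          + (1 - complex.Re (dot (prun v2 U2' pos2 y T2) (prun v2 U2' pos2 y' T2))).
Proof.
move=> n1 uU1 uW1 n2 uU2 uW2 e1 e2 hg.
wlog -> : y y' b / b = true => [wl|].
  case: b => gy gy'; first exact: (wl y y' true).
  by rewrite ![dot (prun _ _ _ y _) _]dotC !cRe_conj; apply: (wl y' y true).
move=> /= gy gy'.
have [/(_ erefl) d1 _] := hg _ _ gy; have [_ /(_ erefl) d2] := hg _ _ gy'.
(* With [x] the sum to be bounded, the weight [lam] yields [2/3 <= 2 * lam * x + 2 / lam]; [lam = 6]
   is optimal and gives 1/36. *)
have six : 0 < 6 :> R by rewrite ltr0n.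
have := @trdist_reduced_le R p1 l1 p2 l2 j (qrun U1 y T1) (qrun U1 y' T1) (qrun U2 y T2) (qrun U2 y' T2) 6.
rewrite !nsqB !(e1, e2) !unitary_nsq // !unitary_dot // !prun_nsq // -!(e1, e2).
move=> /(_ erefl erefl erefl erefl six).
have : 6^-1 * 6 = 1 :> R by rewrite mulVf // pnatr_eq0.
move: d1 d2; lra.
Qed.

Variables (n k m : nat).
Local Notation input := {ffun 'I_n -> bool}.
Local Notation addr := {ffun 'I_k -> bool}.
Local Notation cell := (cell n k m).
Local Notation rank a i := (nat_of_ord (enum_rank (inr (a, i) : cell))).

Lemma block_weight (S : finType) (v0 : Vec R S) U pos (y : {ffun 'I_#|cell| -> bool}) t (a : addr) :
  \sum_(i < m) query_weight v0 U pos y t (pred1 (rank a i)) <=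
  query_weight v0 U pos y t (fun q => @addr_of n k m q == Some a).
Proof.
rewrite /query_weight.
under eq_bigr do rewrite big_mkcond.
rewrite exchange_big [leRHS]big_mkcond /=; apply: ler_sum => s _.
case: eqP => [/addr_ofP [i ->]|no].
  rewrite (bigD1 i) //= eqxx big1 ?addr0 // => i' /negbTE ii.
  have -> : (rank a i == rank a i') = (i' == i).
    by rewrite (inj_eq val_inj) (inj_eq enum_rank_inj); apply/eqP/eqP => [[]|->].
  by rewrite ii.
rewrite big1 // => i _; case: eqP => // e; case: no.
by rewrite e addr_of_rank.
Qed.

Variables (f : pbool_fun n) (j p1 l1 T1 p2 l2 T2 : nat).
Variables (U1 : nat -> Op R (QSt p1 j l1)) (U2 : nat -> Op R (QSt p2 j l2)).
Variables (v1 : Vec R (QSt p1 j l1)) (U1' : nat -> Op R (QSt p1 j l1)) (W1 : Op R (QSt p1 j l1)).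
Variables (pos1 : nat -> QSt p1 j l1 -> nat).
Variables (v2 : Vec R (QSt p2 j l2)) (U2' : nat -> Op R (QSt p2 j l2)) (W2 : Op R (QSt p2 j l2)).
Variables (pos2 : nat -> QSt p2 j l2 -> nat).
Hypothesis n1 : nsq v1 = 1.
Hypothesis uU1 : forall t, unitary (U1' t).
Hypothesis uW1 : unitary W1.
Hypothesis n2 : nsq v2 = 1.
Hypothesis uU2 : forall t, unitary (U2' t).
Hypothesis uW2 : unitary W2.
Hypothesis e1 : forall x : {ffun 'I_#|cell| -> bool}, qrun U1 x T1 = opapp W1 (prun v1 U1' pos1 x T1).
Hypothesis e2 : forall x : {ffun 'I_#|cell| -> bool}, qrun U2 x T2 = opapp W2 (prun v2 U2' pos2 x T2).
Hypothesis szk : forall x v, @lookup_fun n k m f x = Some v ->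
  let d := trdist (reduced (qrun U1 x T1)) (reduced (qrun U2 x T2)) in
  (v = true -> 2 / 3 <= d) /\ (v = false -> d <= 1 / 3).

(* Summing the hybrid bound over all arrays [Y] and all bits of the addressed block: since the parity is sensitive to each of its [m] bits, no square root is lost. *)
Lemma total_block_weight (x : 'I_k -> input) (a : addr) : (forall i, f (x i) = Some (a i)) ->
  #|{: {ffun addr * 'I_m -> bool}}|%:R * m%:R / 72 <=
  \sum_(Y : {ffun addr * 'I_m -> bool})
    (\sum_(t < T1) query_weight v1 U1' pos1 (lookup_input x Y) t (fun q => @addr_of n k m q == Some a)
   + \sum_(t < T2) query_weight v2 U2' pos2 (lookup_input x Y) t (fun q => @addr_of n k m q == Some a)).
Proof.
move=> fx.
pose H (Y : {ffun addr * 'I_m -> bool}) (i : 'I_m) := \sum_(t < T1) query_weight v1 U1' pos1 (lookup_input x Y) t (pred1 (rank a i))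
   + \sum_(t < T2) query_weight v2 U2' pos2 (lookup_input x Y) t (pred1 (rank a i)).
have local Y i : 1 / 36 <= H Y i + H (flip_cell Y (a, i)) i.
  have gy := lookup_funE Y fx; have gy' := lookup_funE (flip_cell Y (a, i)) fx.
  rewrite parity_flip in gy'.
  have sep := szk_separation n1 uU1 uW1 n2 uU2 uW2 e1 e2 szk gy gy'.
  have dif q : q != rank a i -> xbit (lookup_input x Y) q = xbit (lookup_input x (flip_cell Y (a, i))) q.
    exact: xbit_flip.
  have h1 := phase_hybrid pos1 T1 n1 uU1 dif; have h2 := phase_hybrid pos2 T2 n2 uU2 dif.
  rewrite big_split /= in h1; rewrite big_split /= in h2.
  by rewrite /H; move: sep h1 h2; lra.
(* Flipping cell [(a, i)] permutes the arrays, so both terms of [local] have the same sum; this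
   turns 1/36 into 1/72. *)
have perbit i : #|{: {ffun addr * 'I_m -> bool}}|%:R / 72 <= \sum_Y H Y i.
  have : \sum_(Y : {ffun addr * 'I_m -> bool}) (1 / 36) <= \sum_Y (H Y i + H (flip_cell Y (a, i)) i).
    by apply: ler_sum => Y _; apply: local.
  rewrite sumr_const big_split /=.
  rewrite -(reindex_inj (inv_inj (flip_cellK (a, i))) (P := predT) (F := fun Y => H Y i)) /=.
  rewrite -mulr_natr cardE -cardE; lra.
have : \sum_(i < m) #|{: {ffun addr * 'I_m -> bool}}|%:R / 72 <= \sum_(i < m) \sum_Y H Y i.
  by apply: ler_sum => i _; apply: perbit.
rewrite sumr_const card_ord exchange_big /= => le.
have -> : #|{: {ffun addr * 'I_m -> bool}}|%:R * m%:R / 72 = (#|{: {ffun addr * 'I_m -> bool}}|%:R / 72) *+ m :> R.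
  by rewrite mulrAC mulr_natr.
apply: le_trans le _; apply: ler_sum => Y _; rewrite /H big_split /=.
apply: lerD; rewrite exchange_big; apply: ler_sum => t _; exact: block_weight.
Qed.
End Separation.

(** The weight on the addressed block, averaged over instances and summed over arrays, is counted
    twice: the parity forces at least [m / 72] per array, hardness of [f] allows at most
    [T * (2^-1 ^+ k + 2 * eps)]. *)
Lemma query_computes_of_szk (R : realType) n k m (f : pbool_fun n) T M (eps : R) :
  szk_computes R (@lookup_fun n k m f) T -> 0 < eps <= 1 / 2 -> 3 <= eps ^+ 2 * M%:R ->
  T%:R * (2^-1 ^+ k + 2 * eps) < m%:R / 72 ->
  query_computes R f (M * T).
Proof.
move=> [j [p1 [l1 [T1 [U1 [p2 [l2 [T2 [U2 [TT uU1 uU2 szk]]]]]]]]]] e01 hM small.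
have [v1 [U1' [W1 [n1 uU1' uW1 run1]]]] := qrun_phase uU1.
have [v2 [U2' [W2 [n2 uU2' uW2 run2]]]] := qrun_phase uU2.
pose N := #|cell n k m|.
pose X := {x : {ffun 'I_n -> bool} | f x != None}.
pose val (x : X) := f (sval x) == Some true.
have fX (x : X) : f (sval x) = Some (val x) by rewrite /val; case: x => x /=; case: (f x) => // -[].
have triv : exists p : {ffun 'I_n -> bool} -> bool -> R, phase_alg T p.
  exists (fun x o => \sum_(s | true == o) amp2 (prun v1 U1' (fun _ _ => 0%N) x T s)).
  by exists _, v1, U1', (fun _ _ => 0%N), (fun=> true).
apply: (@query_computes_of_average R n f T M X sval val eps) => //.
  move=> x v fx; have xX : f x != None by rewrite fx.
  by exists (exist _ x xX); rewrite // /val /= fx; case: v {fx}.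
(* If no algorithm does well on [mu], then [mu] is a hard distribution, from which the [k] instances
   are drawn independently. *)
move=> mu mu0 mu1; apply: NNPP => no.
have hard p : phase_alg T p -> \sum_x mu x * p (sval x) (val x) <= 1 / 2 + eps.
  move=> cp; rewrite leNgt; apply/negP => lt; apply: no.
  by exists p => //; apply: ltW.
have e0 : 0 <= eps by case/andP: e01 => /ltW.
have le1 : (T1 <= T)%N by rewrite -TT leq_addr.
have le2 : (T2 <= T)%N by rewrite -TT leq_addl.
pose w (xb : {ffun 'I_k -> X}) := \prod_j mu (xb j).
have w0 xb : 0 <= w xb by apply: prodr_ge0.
pose ans (xb : {ffun 'I_k -> X}) : {ffun 'I_k -> bool} := [ffun i => val (xb i)].
have agreeE xb o : agree val k xb o = (o == Some (ans xb)).
  case: o => //= a; apply/forallP/eqP => [h|[->] i]; last by rewrite ltn_ord ffunE eqxx.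
  by congr Some; apply/ffunP => i; rewrite ffunE; have := h i; rewrite ltn_ord => /eqP.
pose B1 (xb : {ffun 'I_k -> X}) (Y : {ffun {ffun 'I_k -> bool} * 'I_m -> bool}) t := query_weight v1 U1' (fun _ => @std_pos N p1 j l1)
  (lookup_input (fun i => sval (xb i)) Y) t (fun q => @addr_of n k m q == Some (ans xb)).
pose B2 (xb : {ffun 'I_k -> X}) (Y : {ffun {ffun 'I_k -> bool} * 'I_m -> bool}) t := query_weight v2 U2' (fun _ => @std_pos N p2 j l2)
  (lookup_input (fun i => sval (xb i)) Y) t (fun q => @addr_of n k m q == Some (ans xb)).
(* The array and the query time are fixed before the instances are drawn; agreement on all [k] bits
   means that the block is the addressed one. *)
have up1 Y t : (t < T1)%N -> \sum_xb w xb * B1 xb Y t <= 2^-1 ^+ k + 2 * eps.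
  move=> tT; have := @hit_average R n k m X sval val mu T eps mu0 mu1 hard _ v1 U1'
    (fun _ => @std_pos N p1 j l1) n1 uU1' Y t (leq_trans (ltnW tT) le1) k e0 (leqnn k).
  congr (_ <= _); apply: eq_bigr => xb _; congr (_ * _).
  by rewrite /hit /B1 /query_weight; apply: eq_bigl => s; rewrite agreeE.
have up2 Y t : (t < T2)%N -> \sum_xb w xb * B2 xb Y t <= 2^-1 ^+ k + 2 * eps.
  move=> tT; have := @hit_average R n k m X sval val mu T eps mu0 mu1 hard _ v2 U2'
    (fun _ => @std_pos N p2 j l2) n2 uU2' Y t (leq_trans (ltnW tT) le2) k e0 (leqnn k).
  congr (_ <= _); apply: eq_bigr => xb _; congr (_ * _).
  by rewrite /hit /B2 /query_weight; apply: eq_bigl => s; rewrite agreeE.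
set C : R := #|{: {ffun {ffun 'I_k -> bool} * 'I_m -> bool}}|%:R.
have C0 : 0 < C by rewrite ltr0n; apply/card_gt0P; exists [ffun=> false].
have low xb : C * m%:R / 72 <= \sum_Y (\sum_(t < T1) B1 xb Y t + \sum_(t < T2) B2 xb Y t).
  apply: (total_block_weight n1 uU1' uW1 n2 uU2' uW2 (fun x => run1 _ x _ (leqnn T1))
     (fun x => run2 _ x _ (leqnn T2)) szk).
  by move=> i; rewrite ffunE; exact: fX.
have tot : C * m%:R / 72 <= \sum_xb w xb * \sum_Y (\sum_(t < T1) B1 xb Y t + \sum_(t < T2) B2 xb Y t).
  rewrite -[leLHS]mul1r -[X in X * _ <= _](weight_sum k mu1) mulr_suml; apply: ler_sum => xb _.
  by apply: ler_wpM2l; [exact: w0|exact: low].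
have : \sum_xb w xb * \sum_Y (\sum_(t < T1) B1 xb Y t + \sum_(t < T2) B2 xb Y t) <=
   C * (T%:R * (2^-1 ^+ k + 2 * eps)).
  have -> : \sum_xb w xb * \sum_Y (\sum_(t < T1) B1 xb Y t + \sum_(t < T2) B2 xb Y t) =
     \sum_Y (\sum_(t < T1) \sum_xb w xb * B1 xb Y t + \sum_(t < T2) \sum_xb w xb * B2 xb Y t).
    under eq_bigr do rewrite mulr_sumr.
    rewrite exchange_big /=; apply: eq_bigr => Y _.
    under eq_bigr do rewrite mulrDr !mulr_sumr.
    by rewrite big_split /=; congr (_ + _); rewrite exchange_big.
  rewrite /C -sum1_card natr_sum mulr_suml; apply: ler_sum => Y _; rewrite mul1r.
  rewrite -TT natrD mulrDl; apply: lerD.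
    rewrite -[X in X%:R * _]card_ord -sum1_card natr_sum mulr_suml; apply: ler_sum => t _.
    by rewrite mul1r up1.
  rewrite -[X in X%:R * _]card_ord -sum1_card natr_sum mulr_suml; apply: ler_sum => t _.
  by rewrite mul1r up2.
move=> hi; have := le_trans tot hi; rewrite -mulrA ler_pM2l // leNgt small //.
Qed.

(** * Existence of algorithms, which makes the minima meaningful *)

Lemma natminP (P : nat -> Prop) : (exists m, P m) -> P (natmin P) /\ forall m, P m -> (natmin P <= m)%N.
Proof.
move=> ex; apply: (epsilon_spec (inhabits 0%N) (fun m => P m /\ forall m', P m' -> (m <= m')%N)).
case: ex => m; elim/ltn_ind: m => m IH Pm.
case: (excluded_middle_informative (exists2 m', (m' < m)%N & P m')) => [[m' lt Pm']|no].
  exact: IH lt Pm'.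
exists m; split=> // m' Pm'; rewrite leqNgt; apply/negP => lt; apply: no.
by exists m'.
Qed.

Section SzkExists.
Variable R : realType.
Local Notation C := (R[i]).

Definition perm_op (S : finType) (h : S -> S) : Op R S := fun s t => (s == h t)%:R.

Lemma unitary_perm (S : finType) (h : S -> S) : injective h -> unitary (perm_op h).
Proof. by move=> hi s t; rewrite /perm_op sum_delta2 (inj_eq hi). Qed.

Lemma opapp_perm_delta (S : finType) (h : S -> S) s : opapp (perm_op h) (basis R s) = basis R (h s).
Proof. by rewrite opapp_delta. Qed.

Lemma opapp_perm (S : finType) (h : S -> S) (v : Vec R S) s : involutive h -> opapp (perm_op h) v s = v (h s).
Proof.
move=> hK; rewrite /opapp /perm_op; under eq_bigr do rewrite -(inj_eq (inv_inj hK)) hK.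
exact: sum_deltal.
Qed.

Lemma oracle_basis n p j l (x : {ffun 'I_n -> bool}) (i : {ffun 'I_p -> bool}) b
    (a : {ffun 'I_j -> bool}) (w : {ffun 'I_l -> bool}) :
  opapp (@oracle R n p j l x) (basis R ((i, b, a, w) : QSt p j l)) =
  basis R ((i, b (+) xbit x (bits_val i), a, w) : QSt p j l).
Proof. exact: oracle_delta. Qed.

Lemma reduced_basis p j l (s : QSt p j l) a b :
  reduced (basis R s) a b = (s.1.2 == a)%:R * (s.1.2 == b)%:R.
Proof.
rewrite reducedE /slice /basis; case: s => [[[i c] u] w] /=.
rewrite (bigD1 ((i, c), w)) //= big1 ?addr0 => [|[ic' w'] ne].
  rewrite !xpair_eqE !eqxx !andbT /= !(eq_sym u) rmorph_nat //.
case: ic' ne => i' c'; rewrite /= !xpair_eqE.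
by case: (i' == i); case: (c' == c); case: (w' == w); rewrite ?andbF ?mul0r.
Qed.

Lemma trpair_basis p j l (s : QSt p j l) M : trpair M (reduced (basis R s)) = M s.1.2 s.1.2.
Proof.
rewrite /trpair; under eq_bigr do under eq_bigr do rewrite reduced_basis mulrCA.
under eq_bigr do rewrite -mulr_sumr.
rewrite sum_deltal; under eq_bigr do rewrite mulrC.
exact: sum_deltal.
Qed.

(** Without a witness [natmin] would be an arbitrary number. One algorithm reads the whole input by
    classical permutations and outputs the value of [g]; the other outputs 0 without queries. Their
    distance is 1 or 0. *)
Lemma szk_exists N (g : pbool_fun N) : exists K, szk_computes R g K.
Proof.
pose S := QSt N 1 N.
pose h (r : 'I_N) (s : S) : S :=
  ([ffun k => s.1.1.1 k (+) (bits N r k (+) bits N r.+1 k)], s.2 r, s.1.2,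
   [ffun i => if i == r then s.1.1.2 else s.2 i]).
have hi r : injective (h r).
  move=> [[[i b] a] w] [[[i' b'] a'] w'] [/ffunP ei ew -> /ffunP eb].
  have -> : i = i' by apply/ffunP => k; have := ei k; rewrite !ffunE => /addIb.
  have -> : b = b' by have := eb r; rewrite !ffunE eqxx.
  congr (_, _); apply/ffunP => q; have := eb q; rewrite !ffunE.
  by case: eqP => [->|].
pose F w := g w == Some true.
pose hF (s : S) : S := (s.1.1.1, s.1.1.2, [ffun q => s.1.2 q (+) F s.2], s.2).
have hFi : injective hF.
  move=> [[[i b] a] w] [[[i' b'] a'] w'] [-> -> /ffunP e ew]; rewrite ew in e *.
  by congr (_, _, _, _); apply/ffunP => q; have := e q; rewrite !ffunE => /addIb.
pose U t : Op R S := if t is t'.+1 then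
  (if insub t' is Some r then perm_op (h r) else perm_op hF) else @idop R S.
have uU t : unitary (U t).
  case: t => [|t]; first exact: unitary_id.
  by rewrite /U; case: insubP => [r _ _|_]; apply: unitary_perm.
pose st t (x : {ffun 'I_N -> bool}) : S :=
  (bits N t, false, [ffun=> false], [ffun i : 'I_N => (i < t)%N && x i]).
have orc (x : {ffun 'I_N -> bool}) t : (t <= N)%N ->
    opapp (@oracle R N N 1 N x) (basis R (st t x)) =
    basis R (bits N t, xbit x t, [ffun=> false], [ffun i : 'I_N => (i < t)%N && x i]).
  move=> tN; rewrite /st oracle_basis addFb; congr (basis R (_, xbit x _, _, _)).
  by rewrite bitsK // (leq_ltn_trans tN) // ltn_expl.
have run (x : {ffun 'I_N -> bool}) t : (t <= N)%N -> qrun U x t = basis R (st t x).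
  elim: t => [_|t IH tN].
    rewrite /= opapp_id; congr (basis R); rewrite /st /qinit; congr (_, _, _, _).
    by apply/ffunP => k; rewrite !ffunE div0n.
  rewrite [LHS]/= IH ?(ltnW tN) // orc ?(ltnW tN) // insubT opapp_perm_delta.
  congr (basis R); rewrite /h /=; congr (_, _, _, _).
  - by apply/ffunP => k; rewrite ffunE addbA addbb.
  - by rewrite ffunE /= ltnn.
  - apply/ffunP => i; rewrite !ffunE ltnS.
    case: (eqVneq i (Ordinal tN)) => [->|ne]; first by rewrite /= leqnn -(xbit_ord x (Ordinal tN)).
    by rewrite /= [in RHS]leq_eqVlt -[t]/(val (Ordinal tN)) (inj_eq val_inj) (negbTE ne).
(* The last query addresses the out-of-range position [N] and returns 0; it only provides the slot
   for the unitary [hF]. *)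
have run1 (x : {ffun 'I_N -> bool}) :
    qrun U x N.+1 = basis R (hF (bits N N, false, [ffun=> false], x)).
  rewrite [LHS]/= run // orc // insubF ?ltnn // opapp_perm_delta xbit_out //.
  congr (basis R (hF (_, _, _, _))); apply/ffunP => i; by rewrite ffunE ltn_ord.
pose U2 (t : nat) : Op R (QSt 0 1 0) := @idop R _.
exists (N.+1 + 0)%N, 1%N, N, N, N.+1, U, 0%N, 0%N, 0%N, U2; split=> //.
  by move=> t _; apply: unitary_id.
move=> x v gx d; have ed : d = trdist (reduced (basis R (hF (bits N N, false, [ffun=> false], x))))
   (reduced (basis R (qinit 0 1 0))) by rewrite /d run1 /= opapp_id.
have herm : forall a b, (fun a b => reduced (basis R (hF (bits N N, false, [ffun=> false], x))) a b -
    reduced (basis R (qinit 0 1 0)) a b) b a = ((fun a b => reduced (basis R (hF (bits N N, false, [ffun=> false], x))) a b -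
    reduced (basis R (qinit 0 1 0)) a b) a b)^*.
  by move=> a b /=; rewrite rmorphB /= -!reduced_herm.
rewrite ed /trdist; split=> vb; rewrite vb in gx.
  (* The sign observable separating |1> from |0>; it shows that the trace norm is at least 2. *)
  pose M : Op R {ffun 'I_1 -> bool} := fun a b => (-1) ^+ (~~ a ord0) * (a == b)%:R.
  have uM : unitary M.
    move=> s t; rewrite -(sum_delta2 R s t); apply: eq_bigr => u _.
    rewrite /M rmorphM rmorph_sign /= mulrACA -signr_addb addbb mul1r.
    by [].
  have := trnorm_ge herm uM; rewrite trpairB !trpair_basis /M !eqxx !mulr1 /= !ffunE /F gx eqxx /=.
  by move: (trnorm _) => tn; lra.
have [M uM ->] := trnorm_attained herm; rewrite trpairB !trpair_basis.
have -> : (hF (bits N N, false, [ffun=> false], x)).1.2 = (qinit 0 1 0).1.2.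
  by apply/ffunP => q; rewrite !ffunE /F gx.
rewrite subrr /= mulr0; lra.
Qed.
End SzkExists.

(** * Parallel composition of protocols *)

Section LocalOperators.
Variable R : realType.
Local Notation C := (R[i]).
Variable N : nat.
Implicit Types (Q : {set 'I_N}) (s t : Str N).

Lemma mask_id Q s : mask Q (mask Q s) = mask Q s.
Proof. by apply/ffunP => i; rewrite !ffunE; case: (i \in Q). Qed.

Lemma agree_mask Q s t : agree_off Q (mask Q s) (mask Q t).
Proof. by apply/forallP => i; apply/implyP => /negbTE iQ; rewrite !ffunE iQ. Qed.

Lemma eq_agree_mask Q s t : (s == t) = agree_off Q s t && (mask Q s == mask Q t).
Proof.
apply/eqP/andP => [->|[/forallP ag /eqP/ffunP m]].
  by split=> //; apply/forallP => i; rewrite eqxx implybT.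
apply/ffunP => i; case iQ : (i \in Q); first by have := m i; rewrite !ffunE iQ.
by apply/eqP; have := ag i; rewrite iQ.
Qed.

Lemma localopP Q (U : Op R (Str N)) :
  localop Q U <-> unitary U /\ forall s t, U s t = (agree_off Q s t)%:R * U (mask Q s) (mask Q t).
Proof.
split=> [[uU [u e]]|[uU e]]; split=> //; last by exists U.
by move=> s t; rewrite !e !mask_id agree_mask mul1r.
Qed.

Lemma localop_id Q : localop Q (@idop R (Str N)).
Proof.
apply/localopP; split=> [|s t]; first exact: unitary_id.
by rewrite /idop (eq_agree_mask Q) -mulnb natrM.
Qed.

(** A permutation of basis states acts on [Q] alone if it fixes the other qubits and its effect on
    [Q] can be computed from the qubits in [Q]. *)
Lemma localop_perm Q (h : Str N -> Str N) : involutive h ->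
  (forall s i, i \notin Q -> h s i = s i) ->
  (forall s i, i \in Q -> h (mask Q s) i = h s i) -> localop Q (perm_op R h).
Proof.
move=> hK off on; apply/localopP; split=> [|s t]; first exact: (unitary_perm _ (inv_inj hK)).
rewrite /perm_op (eq_agree_mask Q s (h t)) -mulnb natrM; congr (_%:R * _%:R).
  congr nat_of_bool; apply: eq_forallb => i; case: (boolP (i \in Q)) => //= iQ; by rewrite off.
congr nat_of_bool; congr (_ == _); apply/ffunP => i; rewrite [LHS]ffunE.
by case: (boolP (i \in Q)) => /= iQ; [rewrite on | rewrite off // ffunE (negbTE iQ)].
Qed.
End LocalOperators.

Section Compose.
Variable R : realType.
Local Notation C := (R[i]).
Variables (N K P : nat).

Definition qubits : finType := (('I_K * 'I_N) + 'I_P + unit)%type.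
Local Notation Reg := (Str #|qubits|).
Local Notation rk q := (enum_rank (q : qubits)).

Definition runs (s : Reg) : {ffun 'I_K -> Str N} := [ffun r => [ffun i => s (rk (inl (inl (r, i))))]].
Definition msg (s : Reg) : {ffun 'I_P -> bool} := [ffun i => s (rk (inl (inr i)))].
Definition ans (s : Reg) : bool := s (rk (inr tt)).
Definition mkreg (rho : {ffun 'I_K -> Str N}) (p : {ffun 'I_P -> bool}) (b : bool) : Reg :=
  [ffun q => match enum_val q with
             | inl (inl ri) => rho ri.1 ri.2 | inl (inr i) => p i | inr _ => b end].

Lemma runs_mk rho p b : runs (mkreg rho p b) = rho.
Proof. by apply/ffunP => r; apply/ffunP => i; rewrite !ffunE enum_rankK. Qed.
Lemma msg_mk rho p b : msg (mkreg rho p b) = p.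
Proof. by apply/ffunP => i; rewrite !ffunE enum_rankK. Qed.
Lemma ans_mk rho p b : ans (mkreg rho p b) = b.
Proof. by rewrite /ans ffunE enum_rankK. Qed.
Lemma mkregK s : mkreg (runs s) (msg s) (ans s) = s.
Proof.
apply/ffunP => q; rewrite ffunE -[q in RHS](enum_valK q).
by case: (enum_val q) => [[[r i]|i]|[]]; rewrite ?ffunE.
Qed.

Lemma eq_reg s t : (s == t) = [&& runs s == runs t, msg s == msg t & ans s == ans t].
Proof.
apply/eqP/and3P => [->|[/eqP e1 /eqP e2 /eqP e3]]; first by split.
by rewrite -(mkregK s) -(mkregK t) e1 e2 e3.
Qed.

Lemma sum_reg (M : nmodType) (G : Reg -> M) :
  \sum_s G s = \sum_rho \sum_p \sum_b G (mkreg rho p b).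
Proof.
under [RHS]eq_bigr do rewrite pair_big; rewrite pair_big /=.
rewrite (reindex (fun q : {ffun 'I_K -> Str N} * ({ffun 'I_P -> bool} * bool) => mkreg q.1 q.2.1 q.2.2)) //=.
exists (fun s => (runs s, (msg s, ans s))) => [[rho [p b]] _|s _] /=.
  by rewrite runs_mk msg_mk ans_mk.
exact: mkregK.
Qed.

Definition par_op (A : 'I_K -> Op R (Str N)) : Op R Reg := fun s t =>
  tensor_op A (runs s) (runs t) * ((msg s == msg t) && (ans s == ans t))%:R.

Definition par_vec (v : 'I_K -> Vec R (Str N)) : Vec R Reg := fun s =>
  tensor_vec v (runs s) * ((msg s == [ffun=> false]) && ~~ ans s)%:R.

Lemma opapp_par A v : opapp (par_op A) (par_vec v) = par_vec (fun r => opapp (A r) (v r)).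
Proof.
apply: functional_extensionality => s.
rewrite /par_vec -opapp_tensor {1}/opapp sum_reg [in RHS]/opapp mulr_suml.
apply: eq_bigr => rho _; rewrite (bigD1 (msg s)) //= [X in _ + X]big1 ?addr0; last first.
  move=> p /negbTE ps; rewrite big1 // => b _.
  by rewrite /par_op msg_mk eq_sym ps /= mulr0 mul0r.
rewrite (bigD1 (ans s)) //= [X in _ + X]big1 ?addr0; last first.
  move=> b /negbTE bs; by rewrite /par_op ans_mk [ans s == b]eq_sym bs andbF mulr0 mul0r.
by rewrite /par_op !runs_mk !msg_mk !ans_mk !eqxx mulr1 mulrA.
Qed.

Lemma unitary_par A : (forall r, unitary (A r)) -> unitary (par_op A).
Proof.
move=> uA s t; rewrite sum_reg eq_reg -mulnb natrM -(unitary_tensor uA) mulr_suml.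
apply: eq_bigr => rho _; rewrite (bigD1 (msg s)) //= [X in _ + X]big1 ?addr0; last first.
  move=> p /negbTE ps; rewrite big1 // => b _.
  by rewrite /par_op msg_mk ps /= mulr0 rmorph0 mul0r.
rewrite (bigD1 (ans s)) //= [X in _ + X]big1 ?addr0; last first.
  move=> b /negbTE bs; by rewrite /par_op ans_mk bs andbF mulr0 rmorph0 mul0r.
by rewrite /par_op !runs_mk !msg_mk !ans_mk !eqxx mulr1 mulrA.
Qed.

(** The owner of the message and answer qubits is left free, since the operator is the identity on
    them. *)
Lemma localop_par (Q : {set 'I_N}) (Q' : {set 'I_#|qubits|}) A :
  (forall r i, (rk (inl (inl (r, i))) \in Q') = (i \in Q)) ->
  (forall r, localop Q (A r)) -> localop Q' (par_op A).
Proof.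
move=> QQ lA; apply/localopP; split.
  by apply: unitary_par => r; case: (lA r).
have lE r s t := proj2 (proj1 (localopP _ _) (lA r)) s t.
have rm s r : runs (mask Q' s) r = mask Q (runs s r).
  by apply/ffunP => i; rewrite !ffunE QQ.
move=> s t; rewrite /par_op /tensor_op.
under eq_bigr do rewrite lE.
under [in RHS]eq_bigr do rewrite !rm.
rewrite big_split /= mulrAC [RHS]mulrCA [RHS]mulrC; congr (_ * _).
have -> : \prod_(r < K) ((agree_off Q (runs s r) (runs t r))%:R : C) =
    [forall r, agree_off Q (runs s r) (runs t r)]%:R.
  case: (boolP [forall _, _]) => [/forallP h|/forallPn [r /negbTE h]].
    by rewrite big1 // => r _; rewrite h.
  by rewrite (bigD1 r) //= h mul0r.
rewrite -!natrM !mulnb; congr (nat_of_bool _)%:R.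
apply/andP/andP => [[/forallP ag /andP[/eqP em /eqP ea]]|[/forallP ag /andP[/eqP em /eqP ea]]].
  split.
    apply/forallP => q; apply/implyP; rewrite -[q](enum_valK q).
    case: (enum_val q) => [[[r i]|i]|[]].
    - by rewrite QQ => iQ; have /forallP/(_ i) := ag r; rewrite iQ /= !ffunE.
    - by move=> _; have /ffunP/(_ i) := em; rewrite !ffunE => ->.
    - by move=> _; apply/eqP.
  apply/andP; split; apply/eqP; last by rewrite /ans !ffunE -!/(ans _) ea.
  by apply/ffunP => i; have /ffunP/(_ i) := em; rewrite !ffunE => ->.
split.
  apply/forallP => r; apply/forallP => i; apply/implyP => iQ.
  by have := ag (rk (inl (inl (r, i)))); rewrite QQ iQ /= !ffunE.
have comp q : mask Q' s q = mask Q' t q -> s q = t q.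
  rewrite !ffunE; case: (boolP (q \in Q')) => //= qQ _.
  by apply/eqP; have := ag q; rewrite qQ.
apply/andP; split; apply/eqP; last exact: comp.
by apply/ffunP => i; rewrite !ffunE; apply: comp; have /ffunP/(_ i) := em; rewrite !ffunE.
Qed.

Lemma card_reg (D : {set 'I_#|qubits|}) :
  #|D| = (\sum_r \sum_i (rk (inl (inl (r, i))) \in D) + \sum_i (rk (inl (inr i)) \in D)
          + (rk (inr tt) \in D))%N.
Proof.
have -> : #|D| = (\sum_(q : qubits) (rk q \in D))%N.
  rewrite -sum1_card big_mkcond /= (reindex (fun q : qubits => rk q)) /=; last first.
    by exists enum_val => q _; [exact: enum_rankK | exact: enum_valK].
  by apply: eq_bigr => q _; case: (_ \in D).
rewrite !big_sumType /= pair_big /=; congr (_ + _ + _)%N; last by rewrite (big_pred1 tt) => [|[]].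
transitivity (\sum_(ri : 'I_K * 'I_N) (rk (inl (inl ri)) \in D))%N => //.
by apply: eq_bigr => -[].
Qed.

Variables (I J I' J' : finType) (own : nat -> {set 'I_N}) (T : nat) (out : 'I_N).
Variables (UA : nat -> I -> Op R (Str N)) (UB : nat -> J -> Op R (Str N)).
Variables (al : 'I_K -> I' -> I) (be : 'I_K -> J' -> J).
Variables (pa : {ffun 'I_K -> bool} -> I' -> {ffun 'I_P -> bool}).
Variables (fin : {ffun 'I_K -> bool} -> {ffun 'I_P -> bool} -> J' -> bool).
Hypothesis localA : forall t a, (t < T)%N -> localop (own t) (UA t a).
Hypothesis localB : forall t b, (t < T)%N -> localop (~: own t) (UB t b).

Definition outs (s : Reg) : {ffun 'I_K -> bool} := [ffun r => runs s r out].

(** Adding the message by xor, while leaving the output qubits that control it intact, makes the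
    step an involution and hence unitary. *)
Definition step_alice a (s : Reg) : Reg :=
  mkreg (runs s) [ffun i => msg s i (+) pa (outs s) a i] (ans s).
Definition step_bob b (s : Reg) : Reg :=
  mkreg (runs s) (msg s) (ans s (+) fin (outs s) (msg s) b).

Lemma outs_mk rho p b : outs (mkreg rho p b) = [ffun r => rho r out].
Proof. by rewrite /outs runs_mk. Qed.

Lemma step_aliceK a : involutive (step_alice a).
Proof.
move=> s; rewrite /step_alice runs_mk msg_mk ans_mk outs_mk -[RHS]mkregK; congr mkreg.
by apply/ffunP => i; rewrite !ffunE -addbA addbb addbF.
Qed.

Lemma step_bobK b : involutive (step_bob b).
Proof.
move=> s; rewrite /step_bob runs_mk msg_mk ans_mk outs_mk -[RHS]mkregK; congr mkreg.
by rewrite -addbA addbb addbF.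
Qed.

(* The [K] copies run in parallel; then Alice receives all output qubits and writes her message; then Bob receives the output qubits and the message and writes the answer. *)
Definition compose_own (t : nat) : {set 'I_#|qubits|} := [set q | match enum_val q with
  | inl (inl ri) => if (t < T)%N then ri.2 \in own t
                    else if t == T then (ri.2 \in own T) || (ri.2 == out)
                    else (ri.2 \in own T) && (ri.2 != out)
  | inl (inr _) => (t <= T)%N
  | inr _ => false end].

Definition compose_alice t a : Op R Reg := if (t < T)%N then par_op (fun r => UA t (al r a))
  else if t == T then perm_op R (step_alice a) else @idop R Reg.
Definition compose_bob t b : Op R Reg := if (t < T)%N then par_op (fun r => UB t (be r b))
  else if t == T then @idop R Reg else perm_op R (step_bob b).

Lemma local_compose_alice t a : localop (compose_own t) (compose_alice t a).
Proof.
rewrite /compose_alice; case: ltnP => tT.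
  by apply: (localop_par (Q := own t)) => [r i|r]; [rewrite inE enum_rankK tT | apply: localA].
case: eqP => [->|_]; last exact: localop_id.
apply: localop_perm; first exact: step_aliceK.
  move=> s q; rewrite inE /step_alice ffunE -{3}[q]enum_valK.
  by case: (enum_val q) => [[[r i]|i]|[]]; rewrite /= ?leqnn // ?ffunE.
move=> s q qQ; have oE : outs (mask (compose_own T) s) = outs s.
  by apply/ffunP => r; rewrite !ffunE inE enum_rankK ltnn eqxx /= eqxx orbT.
rewrite /step_alice oE !ffunE; move: qQ; rewrite inE.
case E : (enum_val q) => [[[r i]|i]|[]] //= qQ; rewrite !ffunE.
  by rewrite inE enum_rankK /= qQ.
by rewrite inE enum_rankK /= qQ.
Qed.

Lemma local_compose_bob t b : localop (~: compose_own t) (compose_bob t b).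
Proof.
rewrite /compose_bob; case: ltnP => tT.
  by apply: (localop_par (Q := ~: own t)) => [r i|r]; [rewrite !inE enum_rankK tT | apply: localB].
case: eqP => [_|tT']; first exact: localop_id.
have nT : (t <= T)%N = false by apply/negbTE; rewrite -ltnNge ltn_neqAle tT andbT; apply/eqP => /esym.
have nT' : (t < T)%N = false by rewrite ltnNge tT.
move/eqP/negbTE: tT' => tT'.
apply: localop_perm; first exact: step_bobK.
  move=> s q; rewrite !inE negbK /step_bob ffunE -{3}[q]enum_valK.
  by case: (enum_val q) => [[[r i]|i]|[]]; rewrite /= ?nT // ?ffunE.
move=> s q qQ; have oE : outs (mask (~: compose_own t) s) = outs s.
  by apply/ffunP => r; rewrite !ffunE !inE enum_rankK nT' tT' /= eqxx andbF.
have mE : msg (mask (~: compose_own t) s) = msg s.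
  by apply/ffunP => r; rewrite !ffunE !inE enum_rankK nT.
have aE : ans (mask (~: compose_own t) s) = ans s by rewrite /ans ffunE !inE enum_rankK.
rewrite /step_bob oE mE aE !ffunE; move: qQ; rewrite !inE.
case E : (enum_val q) => [[[r i]|i]|[]] //= qQ; rewrite !ffunE.
by rewrite !inE enum_rankK /= qQ.
Qed.

(** The copies cost [K] times the original; the output qubits of all copies move at most twice, to
    Alice and on to Bob, and the [P] message qubits move once. *)
Lemma ccost_compose : (ccost compose_own T.+2 <= K * ccost own T + (2 * K + P))%N.
Proof.
rewrite /ccost; pose D t := (own t :\: own t.+1) :|: (own t.+1 :\: own t).
have small (i0 : 'I_N) : (\sum_i (i == i0) = 1)%N.
  by rewrite (bigD1 i0) //= eqxx big1 // => i /negbTE ->.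
have sumK (c : 'I_N -> nat) : (\sum_(r < K) \sum_i c i = K * \sum_i c i)%N.
  by rewrite sum_nat_const card_ord.
have cardD t : (\sum_i (i \in D t) = #|D t|)%N by rewrite -sum1_card [RHS]big_mkcond; apply: eq_bigr => i _; case: (_ \in _).
have bound t : (t < T)%N ->
    (#|(compose_own t :\: compose_own t.+1) :|: (compose_own t.+1 :\: compose_own t)| <= K * #|D t| + (t.+1 == T) * K)%N.
  move=> tT; rewrite card_reg !inE !enum_rankK /=.
  rewrite [X in (_ + X + _)%N]big1 => [|i _]; last by rewrite !inE !enum_rankK (ltnW tT) tT.
  rewrite !addn0 [((t.+1 == T) * K)%N]mulnC -mulnDr -cardD.
  have -> : (t.+1 == T : nat) = (\sum_i (t.+1 == T) * (i == out))%N by rewrite -big_distrr /= small muln1.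
  rewrite -big_split -sumK; apply: leq_sum => r _; apply: leq_sum => i _.
  rewrite /D !inE !enum_rankK tT /=.
  case: (ltngtP t.+1 T) (tT) => // [_ _|<- _]; first by rewrite mul0n addn0; do 2! case: (_ \in _).
  by rewrite mul1n; case: (i == out); do 2! case: (_ \in _).
have boundT : (#|(compose_own T :\: compose_own T.+1) :|: (compose_own T.+1 :\: compose_own T)| <= K + P)%N.
  rewrite card_reg !inE !enum_rankK /= addn0; apply: leq_add.
    rewrite -[leqRHS]muln1 -(small out) -sumK; apply: leq_sum => r _; apply: leq_sum => i _.
    rewrite !inE !enum_rankK /= ltnn eqxx ltnNge leqnSn /= gtn_eqF //.
    by case: (i == out); case: (_ \in _).
  apply: (@leq_trans (\sum_(i < P) 1)%N); last by rewrite sum1_card card_ord.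
  by apply: leq_sum => i _; apply: leq_b1.
have boundT1 : (#|(compose_own T.+1 :\: compose_own T.+2) :|: (compose_own T.+2 :\: compose_own T.+1)| = 0)%N.
  have -> : compose_own T.+2 = compose_own T.+1; last by rewrite setDv setU0 cards0.
  apply/setP => q; rewrite !inE; case: (enum_val q) => [[[r i]|i]|[]] //=.
    rewrite !ltnNge leqnSn (leq_trans (leqnSn _) (leqnSn _)) /= !gtn_eqF //.
  by rewrite ltnn ltnNge leqnSn.
rewrite !big_ord_recr /= boundT1 addn0.
apply: (@leq_trans (\sum_(t < T) (K * #|D t| + (t.+1 == T) * K) + (K + P))%N).
  by apply: leq_add => //; apply: leq_sum => t _; apply: bound.
rewrite big_split /= -big_distrr -big_distrl /= -addnA leq_add2l addnA leq_add2r mul2n -addnn leq_add2r.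
rewrite -[leqRHS]mul1n leq_mul2r; apply/orP; right.
case: (T) => [|T']; first by rewrite big_ord0.
rewrite (bigD1 ord_max) //= eqxx big1 // => t; rewrite -val_eqE eqSS /= => /negbTE ->.
by [].
Qed.

Lemma crun_unit a b t : (t <= T)%N -> nsq (crun UA UB a b t) = 1.
Proof.
elim: t => [_|t IH tT] /=; first by rewrite nsq_Re /dot /basis sum_delta2 eqxx.
have [uA _] := localA a tT; have [uB _] := localB b tT.
by rewrite !unitary_nsq // IH // ltnW.
Qed.

Lemma crun_par a b t : (t <= T)%N ->
  crun compose_alice compose_bob a b t = par_vec (fun r => crun UA UB (al r a) (be r b) t).
Proof.
elim: t => [_|t IH tT].
  apply: functional_extensionality => s; rewrite /par_vec /tensor_vec /= /basis.
  under eq_bigr => r _ do rewrite -[X in _ == X](ffunE (fun=> [ffun=> false]) r).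
  rewrite prod_delta eq_reg -natrM mulnb; congr (nat_of_bool _)%:R.
  have -> : runs ([ffun=> false] : Reg) = [ffun=> [ffun=> false]].
    by apply/ffunP => r; rewrite ffunE; apply/ffunP => i; rewrite !ffunE.
  have -> : msg ([ffun=> false] : Reg) = [ffun=> false] by apply/ffunP => i; rewrite !ffunE.
  have -> : ans ([ffun=> false] : Reg) = false by rewrite /ans ffunE.
  by rewrite eqbF_neg.
by rewrite /= IH ?(ltnW tT) // {1}/compose_bob {1}/compose_alice tT !opapp_par.
Qed.

Definition outcome_prob a b r (w : bool) : R :=
  \sum_(s : Str N | s out == w) amp2 (crun UA UB (al r a) (be r b) T s).

(** The two final steps only permute basis states, so they amount to classical processing of the
    measured outputs. These are independent because the copies are in a product state. *)
Lemma compose_outcome a b v :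
  \sum_(s : Reg | s (rk (inr tt)) == v) amp2 (crun compose_alice compose_bob a b T.+2 s) =
  \sum_(o : {ffun 'I_K -> bool} | fin o (pa o a) b == v) \prod_r outcome_prob a b r (o r).
Proof.
have -> : crun compose_alice compose_bob a b T.+2 =
    fun s => par_vec (fun r => crun UA UB (al r a) (be r b) T) (step_alice a (step_bob b s)).
  rewrite /= crun_par // /compose_alice /compose_bob ltnn eqxx ltnNge leqnSn /= gtn_eqF // !opapp_id.
  apply: functional_extensionality => s.
  by rewrite (opapp_perm _ _ (@step_bobK b)) (opapp_perm _ _ (@step_aliceK a)).
rewrite (reindex (fun s => step_bob b (step_alice a s))) /=; last first.
  exists (fun s => step_alice a (step_bob b s)) => s _.
    by rewrite step_bobK step_aliceK.
  by rewrite step_aliceK step_bobK.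
under eq_bigr do rewrite step_bobK step_aliceK.
rewrite big_mkcond sum_reg /=.
transitivity (\sum_(rho : {ffun 'I_K -> Str N})
   if fin [ffun r => rho r out] (pa [ffun r => rho r out] a) b == v
   then \prod_r amp2 (crun UA UB (al r a) (be r b) T (rho r)) else 0).
  apply: eq_bigr => rho _.
  rewrite (bigD1 [ffun=> false]) //= [X in _ + X]big1 ?addr0; last first.
    move=> p /negbTE pn; rewrite big1 // => c _.
    by rewrite /par_vec msg_mk pn /= mulr0 (amp2_nat _ false) if_same.
  rewrite (bigD1 false) //= [X in _ + X]big1 ?addr0; last first.
    by case=> // _; rewrite /par_vec ans_mk andbF mulr0 (amp2_nat _ false) if_same.
  rewrite /par_vec msg_mk ans_mk eqxx mulr1 runs_mk /tensor_vec amp2_prod.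
  rewrite -/(ans _) /step_bob ans_mk /step_alice !outs_mk !runs_mk !msg_mk ans_mk /=.
  have -> : [ffun i => [ffun=> false] i (+) pa [ffun r => rho r out] a i] = pa [ffun r => rho r out] a.
    by apply/ffunP => i; rewrite !ffunE.
  by rewrite ans_mk.
rewrite -big_mkcond /= (partition_big (fun rho : {ffun 'I_K -> Str N} => [ffun r => rho r out])
   (fun o : {ffun 'I_K -> bool} => fin o (pa o a) b == v)) //=.
apply: eq_bigr => o ho; rewrite /outcome_prob (bigA_distr_big_dep (fun (r : 'I_K) (s : Str N) => s out == o r)) /=.
apply: eq_bigl => rho; apply/andP/familyP => [[_ /eqP <-] r|h]; first by rewrite unfold_in /= ffunE.
have e : [ffun r => rho r out] = o by apply/ffunP => r; rewrite ffunE; apply/eqP/h.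
by rewrite e.
Qed.
End Compose.

(** Reduces the design of a protocol to probability: the [K] runs become independent bits, each
    correct with probability at least 2/3 when its instance lies in the domain. *)
Lemma comm_compose (R : realType) (I J I' J' : finType) (F : I -> J -> option bool) (F' : I' -> J' -> option bool)
    c K P (al : 'I_K -> I' -> I) (be : 'I_K -> J' -> J)
    (pa : {ffun 'I_K -> bool} -> I' -> {ffun 'I_P -> bool})
    (fin : {ffun 'I_K -> bool} -> {ffun 'I_P -> bool} -> J' -> bool) :
  comm_computes R F c ->
  (forall a b v, F' a b = Some v -> forall pr : 'I_K -> bool -> R,
     (forall r w, 0 <= pr r w) -> (forall r, pr r true + pr r false = 1) ->
     (forall r w, F (al r a) (be r b) = Some w -> 2 / 3 <= pr r w) ->
     2 / 3 <= \sum_(o : {ffun 'I_K -> bool} | fin o (pa o a) b == v) \prod_r pr r (o r)) ->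
  exists2 c', comm_computes R F' c' & (c' <= K * c + (2 * K + P))%N.
Proof.
move=> [N [T [own [UA [UB [out [<- lA lB hF]]]]]]] good.
exists (ccost (@compose_own N K P own T out) T.+2); last exact: ccost_compose.
exists #|qubits N K P|, T.+2, (@compose_own N K P own T out), (@compose_alice R N K P I I' T out UA al pa),
  (@compose_bob R N K P J J' T out UB be fin), (enum_rank (inr tt : qubits N K P)); split=> //.
- by move=> t a _; apply: local_compose_alice.
- by move=> t b _; apply: local_compose_bob.
move=> a b v fv; rewrite compose_outcome; apply: good fv _ _ _ _.
- by move=> r w; apply: sumr_ge0 => s _; apply: amp2_ge0.
- move=> r; rewrite -(crun_unit lA lB (al r a) (be r b) (leqnn T)) /nsq.
  by rewrite (partition_big (fun s : Str N => s out) predT) //= big_bool.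
by move=> r w; apply: hF.
Qed.

(** * A protocol for the lookup function *)

Section LookupProtocol.
Variable R : realType.

Lemma comm_none (I J : finType) : comm_computes R (fun (_ : I) (_ : J) => None) 0.
Proof.
exists 1%N, 0%N, (fun _ => set0), (fun _ _ => @idop R _), (fun _ _ => @idop R _), ord0.
by split=> //; rewrite /ccost big_ord0.
Qed.

(** With no copies at all, Alice's message is her whole input in one-hot form and Bob evaluates
    [F]. *)
Lemma comm_exists (I J : finType) (F : I -> J -> option bool) : exists c, comm_computes R F c.
Proof.
pose fin (o : {ffun 'I_0 -> bool}) (p : {ffun 'I_#|I| -> bool}) b :=
  if [pick a | onehot a == p] is Some a then F a b == Some true else false.
have [|c' hc _] := @comm_compose R I J I J (fun _ _ => None) F 0 0 #|I| (fun _ a => a) (fun _ b => b)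
  (fun _ a => onehot a) fin (comm_none I J); last by exists c'.
move=> a b v fv pr pr0 pr1 _.
rewrite (eq_bigl predT) => [|o]; first by rewrite sum_prod1 //; lra.
rewrite /fin; case: pickP => [a' /eqP/onehot_inj ->|/(_ a)]; last by rewrite eqxx.
by rewrite fv; case: (v).
Qed.

Variables (X Y : finType) (G : X -> Y -> bool) (n : nat) (f : pbool_fun n) (k m : nat).
Local Notation cell := (cell n k m).
Local Notation votes := (27 * k)%N.
Local Notation runs := ('I_k * 'I_votes)%type.

Definition instance (Z : finType) (r : 'I_#|{: runs}|) (a : {ffun 'I_#|cell| -> Z}) : {ffun 'I_n -> Z} :=
  [ffun i => a (enum_rank (inl ((enum_val r).1, i) : cell))].

Definition voters (j : 'I_k) : {set 'I_#|{: runs}|} := [set r | (enum_val r).1 == j].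

Definition elected (o : {ffun 'I_#|{: runs}| -> bool}) : {ffun 'I_k -> bool} :=
  [ffun j => (votes < 2 * #|[set r in voters j | o r]|)%N].

Lemma card_voters j : #|voters j| = votes.
Proof.
rewrite -[RHS]card_ord.
have -> : voters j = [set enum_rank (j, u) | u in 'I_votes].
  apply/setP => r; rewrite inE; apply/eqP/imsetP => [e|[u _ ->]]; last by rewrite enum_rankK.
  by exists (enum_val r).2 => //; rewrite -e -surjective_pairing enum_valK.
by rewrite card_imset // => u u' /enum_rank_inj[].
Qed.

Lemma elected_wrong j v o : elected o j != v ->
  (2 * #|[set r in voters j | o r == v]| <= #|voters j|)%N.
Proof.
have split : (#|[set r in voters j | o r]| + #|[set r in voters j | o r == false]| = votes)%N.
  transitivity #|voters j|; last exact: card_voters.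
  rewrite -[RHS](cardsID [set r | o r] (voters j)); congr (_ + _)%N.
    by apply: eq_card => r; rewrite !inE.
  by apply: eq_card => r; rewrite !inE eqbF_neg andbC.
rewrite ffunE card_voters; case: v.
  rewrite eqb_id -leqNgt => h; apply: leq_trans h.
  by rewrite leq_mul2l /=; apply/eq_leq/eq_card => r; rewrite !inE eqb_id.
rewrite eqbF_neg negbK; move: split.
move: #|[set r in voters j | o r]| #|[set r in voters j | o r == false]| => x y; clear; lia.
Qed.

(** Each of Alice's [m] symbols in the elected block is sent in one-hot form at the cost of [#|X|]
    qubits, a constant for a fixed gadget. *)
Definition message (o : {ffun 'I_#|{: runs}| -> bool}) (a : {ffun 'I_#|cell| -> X}) :
    {ffun 'I_#|{: 'I_m * X}| -> bool} :=
  [ffun q => a (enum_rank (inr (elected o, (enum_val q).1) : cell)) == (enum_val q).2].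

Definition verdict (o : {ffun 'I_#|{: runs}| -> bool}) (p : {ffun 'I_#|{: 'I_m * X}| -> bool})
    (b : {ffun 'I_#|cell| -> Y}) : bool :=
  \big[addb/false]_(i < m) [exists z, p (enum_rank (i, z)) && G z (b (enum_rank (inr (elected o, i) : cell)))].

Lemma verdictE o a b : verdict o (message o a) b =
  \big[addb/false]_(i < m) G (a (enum_rank (inr (elected o, i) : cell))) (b (enum_rank (inr (elected o, i) : cell))).
Proof.
apply: eq_bigr => i _; apply/existsP/idP => [[z]|g]; first by rewrite ffunE enum_rankK => /andP[/eqP /= <-].
by exists (a (enum_rank (inr (elected o, i) : cell))); rewrite ffunE enum_rankK eqxx.
Qed.

Lemma comm_lookup c : comm_computes R (gcompose f G) c ->
  exists2 c', comm_computes R (gcompose (@lookup_fun n k m f) G) c' &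
    (c' <= 27 * k ^ 2 * (c + 2) + m * #|X|)%N.
Proof.
move=> /(@comm_compose R _ _ _ _ _ (gcompose (@lookup_fun n k m f) G) c #|{: runs}| #|{: 'I_m * X}|
  (@instance X) (@instance Y) message verdict) [|c' hc le]; last first.
  exists c' => //; apply: (leq_trans le); rewrite !card_prod !card_ord.
  by apply/eq_leq; rewrite -mulnn; lia.
move=> a b v; rewrite /gcompose /lookup_fun.
set y : {ffun 'I_#|cell| -> bool} := [ffun c => G (a c) (b c)].
case: ifP => // /forallP dom [ev] pr pr0 pr1 hpr.
pose l : {ffun 'I_k -> bool} := [ffun j => f (lookup_block y j) == Some true].
have fl j : f (lookup_block y j) = Some (l j).
  by rewrite ffunE; have := dom j; case: (f _) => // -[].
have prl r : 2 / 3 <= pr r (l (enum_val r).1).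
  apply: hpr; rewrite -fl; congr f; apply/ffunP => i; by rewrite !ffunE.
have w0 (o : {ffun 'I_#|{: runs}| -> bool}) : 0 <= \prod_r pr r (o r) by apply: prodr_ge0.
have tot := sum_prod1 pr1; rewrite (bigID (fun o => elected o == l)) /= in tot.
have le : \sum_(o | elected o == l) \prod_r pr r (o r) <=
   \sum_(o | verdict o (message o a) b == v) \prod_r pr r (o r).
  rewrite big_mkcond [leRHS]big_mkcond; apply: ler_sum => o _.
  case: eqP => [eo|_]; last by case: ifP.
  rewrite ifT // verdictE eo -ev; apply/eqP/eq_bigr => i _.
  by rewrite /lookup_cell ffunE.
have bad : \sum_(o | elected o != l) \prod_r pr r (o r) <= 1 / 3.
  apply: (@le_trans _ _ (\sum_(j < k) \sum_(o : {ffun 'I_#|{: runs}| -> bool} |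
      (2 * #|[set r in voters j | o r == l j]| <= #|voters j|)%N) \prod_r pr r (o r))).
    under [leRHS]eq_bigr do rewrite big_mkcond.
    rewrite exchange_big big_mkcond /=; apply: ler_sum => o _.
    case: eqP => [_|ne] /=; first by apply: sumr_ge0 => j _; case: ifP.
    have [j ej] : exists j, elected o j != l j.
      case: (pickP (fun j => elected o j != l j)) => [j ej|none]; first by exists j.
      by case: ne; apply/ffunP => j; apply/eqP/negbFE/none.
    rewrite (bigD1 j) //= (elected_wrong ej) lerDl; apply: sumr_ge0 => i _; by case: ifP.
  case k0 : (k == 0)%N; first by rewrite big1 ?divr_ge0 // => j; have := ltn_ord j; rewrite [X in (_ < X)%N](eqP k0).
  (* A run is right with probability 2/3 = 1/2 + 1/6, so [27 * k] votes leave an error of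
     [1 / (3 * k)] per instance, and 1/3 over all [k] instances. *)
  apply: (@le_trans _ _ (\sum_(j < k) (4 * (1 / 6) ^+ 2 * votes%:R)^-1)).
    apply: ler_sum => j _.
    have := @majority_error R _ pr pr0 pr1 (voters j) (l j) (1 / 6).
    have kp : (0 < k)%N by rewrite lt0n k0.
    rewrite card_voters muln_gt0 kp; apply=> //; first by rewrite divr_gt0 ?ltr0n.
    by move=> r; rewrite inE => /eqP <-; have := prl r; lra.
  rewrite sumr_const card_ord -[leLHS]mulr_natl (natrM _ 27 k).
  have kn0 : k%:R != 0 :> R by rewrite pnatr_eq0 k0.
  by rewrite [leLHS](_ : _ = 1 / 3) //; field.
by move: tot le bad; lra.
Qed.
End LookupProtocol.

(** * Polylogarithmic bounds *)

Section Arithmetic.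
Local Open Scope nat_scope.

(** With [h] the quotient of [l] by [a], the bound [l <= a * h.+1 <= a * 2 ^ h] is raised to the
    power [a] (for positive [a]). *)
Lemma pow_le_exp2 a : exists2 E, 0 < E & forall l, l ^ a <= E * 2 ^ l.
Proof.
case: a => [|a]; first by exists 1 => // l; rewrite expn0 mul1n expn_gt0.
exists (a.+1 ^ a.+1); first by rewrite expn_gt0.
move=> l; pose h := l %/ a.+1.
have lh : l <= a.+1 * 2 ^ h.
  apply: (@leq_trans (a.+1 * h.+1)); last by rewrite leq_mul2l ltn_expl.
  by rewrite mulnC ltnW // ltn_ceil.
apply: (@leq_trans ((a.+1 * 2 ^ h) ^ a.+1)); first by rewrite leq_exp2r.
rewrite expnMn leq_mul2l -expnM leq_exp2l //.
by rewrite leq_trunc_div orbT.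
Qed.

Lemma poly_le_exp2 D a : exists L0, forall l, L0 <= l -> D * l ^ a <= 2 ^ l.
Proof.
have [E E0 hE] := pow_le_exp2 a.+1; exists (D * E) => l le.
rewrite -(leq_pmul2l E0); apply: leq_trans (hE l).
by rewrite expnS mulnA leq_mul2r mulnC le orbT.
Qed.

(* With [u = up_log 2 T] and [u ^ (2 * kap) <= E * 2 ^ u], squaring the bound on [T] gives [u = O(L)]. *)
Lemma polylog_bootstrap B N0 kap : exists G a, 0 < G /\ forall L m T, 0 < L -> 0 < m -> m <= 2 ^ L ->
  (N0 <= T -> T <= B * L ^ 2 * m * up_log 2 T ^ kap) -> T <= G * L ^ a * m.
Proof.
have [E E0 hE] := pow_le_exp2 (2 * kap); have [E4 E40 hE4] := pow_le_exp2 4.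
pose W := 4 * B ^ 2 * E * E4; pose w := up_log 2 W.
exists (B * (w + 3) ^ kap + N0).+1, (kap + 2); split=> // L m T L0 m0 mL hT.
have big : (B * (w + 3) ^ kap + N0) * L ^ (kap + 2) * m <= (B * (w + 3) ^ kap + N0).+1 * L ^ (kap + 2) * m.
  by rewrite leq_mul2r leq_mul2r leqnSn !orbT.
apply: leq_trans big; case: (leqP N0 T) => [/hT {}hT|lt]; last first.
  rewrite mulnDl mulnDl (leq_trans (ltnW lt)) // (leq_trans _ (leq_addl _ _)) //.
  by rewrite -mulnA leq_pmulr // muln_gt0 expn_gt0 L0.
set u := up_log 2 T in hT.
have uw : u <= (w + 3) * L.
  case: (posnP u) => [->//|u0].
  have T0 : 2 ^ u <= 2 * T.
    have : 2 ^ u.-1 < T by apply: up_log_gtn => //; move: u0; rewrite up_log_gt0.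
    by rewrite -{2}(prednK u0) expnS; lia.
  (* The exponent [3 * L] consists of [2 * L] from [m ^ 2] and [L] from [L ^ 4 <= E4 * 2 ^ L]. One
     factor [2 ^ u] absorbs [u ^ (2 * kap)] and cancels. *)
  have sq : 2 ^ u * 2 ^ u <= W * 2 ^ (3 * L) * 2 ^ u.
    apply: (@leq_trans ((2 * T) ^ 2)); first by rewrite -mulnn leq_mul.
    apply: (@leq_trans ((2 * (B * L ^ 2 * 2 ^ L * u ^ kap)) ^ 2)).
      rewrite leq_exp2r // leq_mul2l /= (leq_trans hT) // leq_mul2r; apply/orP; right.
      by rewrite leq_mul2l mL orbT.
    have -> : (2 * (B * L ^ 2 * 2 ^ L * u ^ kap)) ^ 2 = 4 * B ^ 2 * L ^ 4 * 2 ^ (2 * L) * u ^ (2 * kap).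
      rewrite !expnMn -!expnM ![_ * 2]mulnC !mulnA; congr (_ * _ * _ * _ * _).
    have -> : W * 2 ^ (3 * L) * 2 ^ u = 4 * B ^ 2 * (E4 * 2 ^ L) * 2 ^ (2 * L) * (E * 2 ^ u).
      by rewrite (_ : 3 * L = L + 2 * L) ?expnD /W; last lia; ring.
    by rewrite leq_mul // leq_mul2r leq_mul2l hE4 !orbT.
  rewrite leq_pmul2r ?expn_gt0 // in sq.
  have : 2 ^ u <= 2 ^ (w + 3 * L).
    by rewrite expnD (leq_trans sq) // leq_mul2r up_logP ?orbT.
  rewrite leq_exp2l // => /leq_trans; apply.
  by rewrite mulnDl leq_add2r leq_pmulr.
apply: (leq_trans hT); rewrite mulnDl mulnDl; apply: leq_trans (leq_addr _ _).
have e x y z : B * y * (z * x) * m = B * x * m * (y * z) by ring.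
rewrite expnD e leq_mul2l -expnMn; apply/orP; right.
by case: (kap) => // kp; rewrite leq_exp2r.
Qed.
End Arithmetic.

(** For [eps = (576 * r)^-1] both summands [2^-1 ^+ k] and [2 * eps] are at most [(288 * r)^-1], so
    the weight is at most [m / 144], below the required [m / 72]. *)
Lemma query_computes_of_szk_ratio (R : realType) n k m (f : pbool_fun n) T r :
  szk_computes R (@lookup_fun n k m f) T -> (0 < r)%N -> (0 < m)%N -> (T <= r * m)%N ->
  (288 * r <= 2 ^ k)%N -> query_computes R f (3 * (576 * r) ^ 2 * T).
Proof.
move=> szk r0 m0 Tr rk; have r0' : 0 < r%:R :> R by rewrite ltr0n.
have m0' : 0 < m%:R :> R by rewrite ltr0n.
have r1 : 1 <= r%:R :> R by rewrite ler1n.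
have er : (576 * r%:R)^-1 * (576 * r%:R) = 1 :> R by rewrite mulVf // lt0r_neq0 // mulr_gt0.
have e0 : 0 < (576 * r%:R)^-1 :> R by rewrite invr_gt0 mulr_gt0.
apply: (query_computes_of_szk (eps := (576 * r%:R)^-1) szk).
- by rewrite e0 /=; nra.
- rewrite natrM natrX natrM mulrCA -exprMn er expr1n mulr1 //.
have p2 : 0 < 2 ^+ k :> R by rewrite exprn_gt0.
have e2 : 2^-1 ^+ k * 2 ^+ k = 1 :> R by rewrite -exprMn mulVf ?expr1n // pnatr_eq0.
have e20 : 0 < 2^-1 ^+ k :> R by rewrite exprn_gt0 // invr_gt0.
have rk' : 288 * r%:R <= 2 ^+ k :> R by rewrite -natrX -natrM ler_nat.
have h1 : 2^-1 ^+ k * (288 * r%:R) <= 1 :> R by rewrite -[leRHS]e2 ler_pM2l.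
have Tr' : T%:R <= r%:R * m%:R :> R by rewrite -natrM ler_nat.
set x : R := 2^-1 ^+ k in e20 h1 *; set e : R := _^-1 in e0 er *.
have h2 : T%:R * (x + 2 * e) <= (r%:R * m%:R) * (x + 2 * e) by rewrite ler_wpM2r // ltW // addr_gt0 ?mulr_gt0.
apply: (le_lt_trans h2).
have h3 : r%:R * (x + 2 * e) <= 144^-1 by lra.
have -> : r%:R * m%:R * (x + 2 * e) = r%:R * (x + 2 * e) * m%:R by rewrite mulrAC.
apply: (@le_lt_trans _ _ (144^-1 * m%:R)); first by rewrite ler_wpM2r // ltW.
rewrite mulrC ltr_pM2l //; lra.
Qed.

Theorem theorem19 (R : realType) (X Y : finType) (G : X -> Y -> bool)
  (QSZKcc : forall I J : finType, (I -> J -> option bool) -> nat) :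
  (* QSZK^cc(F) = O(Q^cc(F)) for every two-party partial function F *)
  (exists c : nat, forall (I J : finType) (F : I -> J -> option bool),
      (QSZKcc I J F <= c * Qcc R F + c)%N) ->
  (* QSZK^cc(f o G) = Omega~(QSZK(f)) for every partial Boolean f *)
  (exists d k N0 : nat, (0 < d)%N /\
     forall (n : nat) (f : pbool_fun n), (N0 <= QSZKquery R f)%N ->
       (QSZKquery R f <= d * QSZKcc _ _ (gcompose f G) * (up_log 2 (QSZKquery R f)) ^ k)%N) ->
  (* Q^cc(f o G) = Omega~(Q(f)) for every partial Boolean f *)
  exists d k N0 : nat, (0 < d)%N /\
     forall (n : nat) (f : pbool_fun n), (N0 <= Qquery R f)%N ->
       (Qquery R f <= d * Qcc R (gcompose f G) * (up_log 2 (Qquery R f)) ^ k)%N.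
Proof.
move=> [c hc] [d [kap [N0 [d0 hd]]]].
(* [A] comes from [27 * (C + 2) <= 54 * m] and the message of [m * #|X|] qubits; [B] also absorbs
   the additive constant [c]. *)
pose A := (54 + #|X|)%N; pose B := (d * (c * (A + 1)))%N.
have [Gam [a [Gam0 boot]]] := polylog_bootstrap B N0 kap.
have [L0 hL0] := poly_le_exp2 (288 * Gam) a.
(* The ratio [r = Gam * L ^ a] enters three times: squared in the number of votes and once in
   [T <= r * m]. *)
pose D := (3 * 576 ^ 2 * Gam ^ 3)%N.
have D0 : (0 < D)%N by rewrite muln_gt0 muln_gt0 !expn_gt0 Gam0.
have DE : D = (3 * 576 ^ 2 * Gam ^ 3)%N by []; clearbody D.
have [L1 hL1] := poly_le_exp2 (2 * D) (3 * a).
exists (2 * D)%N, (3 * a)%N, (2 ^ (L0 + L1 + 1))%N; split; first by rewrite muln_gt0 D0.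
move=> n f; set q := Qquery R f; set C := Qcc R (gcompose f G); set L := up_log 2 q => hq.
have LL : (L0 + L1 + 1 <= L)%N.
  by rewrite -(leq_exp2l (m := 2)) // (leq_trans hq) // up_logP.
have Lp : (0 < L)%N by apply: leq_trans LL; rewrite addn1.
have La0 e : (0 < L ^ e)%N by rewrite expn_gt0 Lp.
(* In the remaining case [C < q <= 2 ^ L], so [m = C.+1] is positive and at most [2 ^ L], as the
   bootstrap requires. *)
have [qC|Cq] := leqP q C.
  by rewrite (leq_trans qC) // mulnAC leq_pmull // !muln_gt0 D0 La0.
pose m := C.+1; pose T := QSZKquery R (@lookup_fun n L m f).
have mL : (m <= 2 ^ L)%N by rewrite (leq_trans Cq) // up_logP.
have szkT : szk_computes R (@lookup_fun n L m f) T := proj1 (natminP (szk_exists R _)).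
have commC : comm_computes R (gcompose f G) C := proj1 (natminP (comm_exists R _)).
have Qcc' : (Qcc R (gcompose (@lookup_fun n L m f) G) <= A * L ^ 2 * m)%N.
  have [c' hc' le] := comm_lookup L m commC.
  apply: leq_trans (proj2 (natminP (comm_exists R _)) _ hc') (leq_trans le _).
  rewrite /A mulnDl mulnDl [(m * _)%N]mulnC; apply: leq_add; last first.
    by rewrite leq_mul2r leq_pmulr ?orbT.
  have -> : (54 * L ^ 2 * m = 27 * L ^ 2 * (2 * m))%N by ring.
  by rewrite leq_mul2l /m; apply/orP; right; lia.
have Tm : (T <= Gam * L ^ a * m)%N.
  apply: boot => // hT; apply: leq_trans (hd _ _ hT) _.
  rewrite leq_mul2r /B -!mulnA leq_mul2l !mulnA; apply/orP; right; apply/orP; right.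
  apply: leq_trans (hc _ _ _) _.
  apply: (@leq_trans (c * (A * L ^ 2 * m) + c * (L ^ 2 * m))%N).
    by apply: leq_add; rewrite ?leq_mul2l ?Qcc' ?orbT // leq_pmulr // muln_gt0 La0.
  by apply/eq_leq; move: (L) (A) (m) => z u v; ring.
pose r := (Gam * L ^ a)%N.
have r0 : (0 < r)%N by rewrite muln_gt0 Gam0 La0.
have rL : (288 * r <= 2 ^ L)%N.
  by rewrite mulnA hL0 // (leq_trans _ LL) // -addnA leq_addr.
have comp := query_computes_of_szk_ratio szkT r0 (ltn0Sn C) Tm rL.
have qle : (q <= D * L ^ (3 * a) * m)%N.
  apply: leq_trans (proj2 (natminP (ex_intro _ _ comp)) _ comp) _.
  apply: (@leq_trans (3 * (576 * r) ^ 2 * (r * m))%N); first by rewrite leq_mul2l Tm orbT.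
  apply/eq_leq; rewrite DE /r [(3 * a)%N]mulnC expnM.
  by move: (L ^ a)%N => z; ring.
(* For positive [C] the block length is at most [2 * C]. The case [C = 0] is impossible: [q] would
   be at most [D * L ^ (3 * a)], but it exceeds [2 ^ L.-1], which is larger once [L1 <= L]. *)
move: qle; rewrite /m; case: (C) => [|C'] qle.
  have : (2 ^ L.-1 < q)%N by apply: up_log_gtn => //; move: Lp; rewrite up_log_gt0.
  have L1L : (L1 <= L)%N by rewrite (leq_trans _ LL) // addn1 ltnW // ltnS leq_addl.
  have := hL1 L L1L; rewrite -mulnA -[X in (2 ^ X)%N](prednK Lp) expnS leq_pmul2l // => h lq.
  by have := leq_trans lq qle; rewrite muln1 => /leq_trans/(_ h); rewrite ltnn.
apply: leq_trans qle _.
have -> : (2 * D * C'.+1 * L ^ (3 * a) = D * L ^ (3 * a) * (2 * C'.+1))%N by ring.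
by rewrite leq_mul2l; apply/orP; right; lia.
Qed.
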